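(* Let $(\mathcal{C}:A)$, $(\mathcal{D}:B)$ be corings with $_A\mathcal{C}$ and $_B\mathcal{D}$ locally projective, and let $(\theta:\beta):(\mathcal{C}:A)\to(\mathcal{D}:B)$ be a compatible morphism of corings. Then $(-\otimes_A B,\ \mathrm{Coind}_{\mathcal{D}}^{\mathcal{C}}(-))$ is a pair of adjoint functors, i.e. the induction functor $-\otimes_A B:\mathbb{M}^{\mathcal{C}}\to\mathbb{M}^{\mathcal{D}}$ is left adjoint to $$\mathrm{Coind}_{\mathcal{D}}^{\mathcal{C}}(-):\mathbb{M}^{\mathcal{D}}\to\mathbb{M}^{\mathcal{C}},\quad N\mapsto\mathrm{Rat}^{\mathcal{C}}(\mathrm{Hom}_{-^{\ast}\mathcal{D}}({}_{\#}\mathcal{C},N)).$$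
   Context: $R$ is a commutative ring with $1_R\neq0_R$; $A$, $B$ are arbitrary $R$-algebras. $B$-modules are regarded as $A$-modules through $\beta$. Corings: an $A$-coring is an $A$-bimodule $\mathcal{C}$ with $A$-bilinear coassociative comultiplication $\Delta_{\mathcal{C}}$, $c\mapsto\sum c_1\otimes_A c_2$, and $A$-bilinear counit $\varepsilon_{\mathcal{C}}:\mathcal{C}\to A$; $(\mathcal{C}:A)$ means that $\mathcal{C}$ is an $A$-coring. A morphism of corings $(\theta:\beta):(\mathcal{C}:A)\to(\mathcal{D}:B)$ is an $R$-algebra morphism $\beta:A\to B$ together with an $(A,A)$-bilinear map $\theta:\mathcal{C}\to\mathcal{D}$ such that $\chi\circ(\theta\otimes_A\theta)\circ\Delta_{\mathcal{C}}=\Delta_{\mathcal{D}}\circ\theta$, with $\chi:\mathcal{D}\otimes_A\mathcal{D}\to\mathcal{D}\otimes_B\mathcal{D}$ canonical, and $\varepsilon_{\mathcal{D}}\circ\theta=\beta\circ\varepsilon_{\mathcal{C}}$. Duals: $^{\ast}\mathcal{C}:=\mathrm{Hom}_{A-}(\mathcal{C},A)$ (left $A$-linear maps) is a ring with product $(f\star_l g)(c)=\sum g(c_1f(c_2))$ and unit $\varepsilon_{\mathcal{C}}$; likewise $^{\ast}\mathcal{D}:=\mathrm{Hom}_{B-}(\mathcal{D},B)$. $^{\#}\mathcal{C}:=\mathrm{Hom}_{A-}(\mathcal{C},B)$ is a $({}^{\ast}\mathcal{C},{}^{\ast}\mathcal{D})$-bimodule through $(\phi\rightharpoonup h)(c)=\sum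 h(c_1\phi(c_2))$ and $(h\leftharpoonup g)(c)=\sum g(\theta(c_1)h(c_2))$. Put $_{\#}\mathcal{C}:=\{\beta\circ\phi:\phi\in{}^{\ast}\mathcal{C}\}$ and $_{\#}\mathcal{D}:=\{g\circ\theta:g\in{}^{\ast}\mathcal{D}\}$ in $^{\#}\mathcal{C}$. $(\theta:\beta)$ is compatible if $_{\#}\mathcal{D}\subseteq{}_{\#}\mathcal{C}$ (i.e. for every $g\in{}^{\ast}\mathcal{D}$ there is $f\in{}^{\ast}\mathcal{C}$ with $\beta\circ f=g\circ\theta$); then $_{\#}\mathcal{C}$ is a $({}^{\ast}\mathcal{C},{}^{\ast}\mathcal{D})$-subbimodule of $^{\#}\mathcal{C}$. A left $A$-module $W$ is locally projective if for every surjective $A$-linear map $\pi:L\to N$, every $A$-linear $g:W\to N$ and every finitely generated submodule $F\subseteq W$ there is an $A$-linear $g':W\to L$ with $g|_F=(\pi\circ g')|_F$. Comodules: $\mathbb{M}^{\mathcal{C}}$ is the category of counital right $\mathcal{C}$-comodules (coaction $m\mapsto\sum m_{<0>}\otimes_A m_{<1>}$) with colinear maps. $N\in\mathbb{M}^{\mathcal{D}}$ is a right $^{\ast}\mathcal{D}$-module via $ng=\sum n_{<0>}g(n_{<1>})$. Induction functor: for $M\in\mathbb{M}^{\mathcal{C}}$, $M\otimes_A B$ is a right $\mathcal{D}$-comodule via $M\otimes_A B\to(M\otimes_A B)\otimes_B\mathcal{D}\simeq M\otimes_A\mathcal{D}$, $m\otimes_A b\mapsto\sum m_{<0>}\otimes_A\theta(m_{<1>})b$.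 Coinduction: $\mathrm{Hom}_{-^{\ast}\mathcal{D}}({}_{\#}\mathcal{C},N)$ (right $^{\ast}\mathcal{D}$-linear maps) is a right $^{\ast}\mathcal{C}$-module by $(\varphi\leftharpoonup\psi)(h)=\varphi(\psi\rightharpoonup h)$. For a right $^{\ast}\mathcal{C}$-module $X$, $\mathrm{Rat}^{\mathcal{C}}(X)$ is the set of $x\in X$ for which there is a (necessarily unique, as $_A\mathcal{C}$ is locally projective) $\sum x_i\otimes_A c_i\in X\otimes_A\mathcal{C}$ with $xf=\sum x_if(c_i)$ for all $f\in{}^{\ast}\mathcal{C}$; it is a right $\mathcal{C}$-comodule via $x\mapsto\sum x_i\otimes_A c_i$. *)

(* Defs.v *)
From HB Require Import structures.
From mathcomp Require Import all_boot all_algebra.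
From mathcomp Require Import boolp functions.

Set Implicit Arguments.
Unset Strict Implicit.
Unset Printing Implicit Defensive.

Import GRing.Theory.
Local Open Scope ring_scope.
Local Open Scope quotient_scope.

(* The library's algType excludes the zero ring; here the zero algebra is
   allowed: an R-algebra is a ring A with a ring morphism from R to its
   center. *)
Record ralgebra (R : comNzRingType) := RAlgebra {
  ralg_ring :> pzRingType;
  ralg_unit : {rmorphism R -> ralg_ring};
  ralg_central : forall k x, ralg_unit k * x = x * ralg_unit k
}.

Definition ralg_morphism (R : comNzRingType) (A B : ralgebra R)
    (beta : {rmorphism A -> B}) : Prop :=
  forall k : R, beta (ralg_unit A k) = ralg_unit B k.

HB.mixin Record Zmodule_isRmodule (A : pzRingType) V of GRing.Zmodule V := {
  ract : V -> A -> V;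
  ractA : forall v a b, ract (ract v a) b = ract v (a * b);
  ract1 : forall v, ract v 1 = v;
  ractDl : forall v w a, ract (v + w) a = ract v a + ract w a;
  ractDr : forall v a b, ract v (a + b) = ract v a + ract v b
}.

#[short(type="rmodType")]
HB.structure Definition Rmodule (A : pzRingType) :=
  {V of GRing.Zmodule V & Zmodule_isRmodule A V}.

Notation "v *> a" := (ract v a) (at level 40, left associativity) : ring_scope.

HB.mixin Record isBimodule (A B : pzRingType) V
    of GRing.Lmodule A V & Rmodule B V := {
  lractA : forall (a : A) (v : V) (b : B), (a *: v) *> b = a *: (v *> b)
}.

#[short(type="bimodType")]
HB.structure Definition Bimodule (A B : pzRingType) :=
  {V of GRing.Lmodule A V & Rmodule B V & isBimodule A B V}.

Section RmoduleTheory.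
Variables (A : pzRingType) (V : rmodType A).
Implicit Types (v w : V) (a : A).

Lemma ract0l a : (0 : V) *> a = 0.
Proof. by apply: (@addrI _ ((0 : V) *> a)); rewrite -ractDl !addr0. Qed.

Lemma ract0r v : v *> (0 : A) = 0.
Proof. by apply: (@addrI _ (v *> (0 : A))); rewrite -ractDr !addr0. Qed.

Lemma ractNl v a : (- v) *> a = - (v *> a).
Proof. by apply: (@addrI _ (v *> a)); rewrite -ractDl !subrr ract0l. Qed.

Lemma ractNr v a : v *> (- a) = - (v *> a).
Proof. by apply: (@addrI _ (v *> a)); rewrite -ractDr !subrr ract0r. Qed.

Lemma ract_suml I (r : seq I) (P : pred I) (F : I -> V) a :
  (\sum_(i <- r | P i) F i) *> a = \sum_(i <- r | P i) F i *> a.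
Proof.
apply: (big_morph (fun v => v *> a)); last exact: ract0l.
by move=> v w; exact: ractDl.
Qed.
End RmoduleTheory.

Definition reg (A : pzRingType) : Type := A.

Section Regular.
Variable A : pzRingType.
HB.instance Definition _ := GRing.Zmodule.copy (reg A) A.

Let scale (a : A) (x : reg A) : reg A := a * (x : A).
Fact reg_scalerA a b v : scale a (scale b v) = scale (a * b) v.
Proof. exact: mulrA. Qed.
Fact reg_scale1r : left_id 1 scale. Proof. exact: mul1r. Qed.
Fact reg_scalerDr : right_distributive scale +%R. Proof. exact: mulrDr. Qed.
Fact reg_scalerDl v : {morph scale^~ v : a b / a + b}.
Proof. by move=> a b; exact: mulrDl. Qed.
HB.instance Definition _ := GRing.Zmodule_isLmodule.Build A (reg A)
  reg_scalerA reg_scale1r reg_scalerDr reg_scalerDl.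

Let act (x : reg A) (a : A) : reg A := (x : A) * a.
Fact reg_ractA v a b : act (act v a) b = act v (a * b).
Proof. by rewrite /act mulrA. Qed.
Fact reg_ract1 v : act v 1 = v. Proof. exact: mulr1. Qed.
Fact reg_ractDl v w a : act (v + w) a = act v a + act w a.
Proof. exact: mulrDl. Qed.
Fact reg_ractDr v a b : act v (a + b) = act v a + act v b.
Proof. exact: mulrDr. Qed.
HB.instance Definition _ := Zmodule_isRmodule.Build A (reg A)
  reg_ractA reg_ract1 reg_ractDl reg_ractDr.

Fact reg_lractA (a : A) (v : reg A) (b : A) : (a *: v) *> b = a *: (v *> b).
Proof. by rewrite /GRing.scale /ract /= /scale /act mulrA. Qed.
HB.instance Definition _ := isBimodule.Build A A (reg A) reg_lractA.
End Regular.

(* Restriction of scalars along beta on the left, resp. on the right; the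
   action on the other side is kept. *)
Definition resL (A B : pzRingType) (beta : {rmorphism A -> B}) (V : Type)
  : Type := V.
Definition resR (A B : pzRingType) (beta : {rmorphism A -> B}) (V : Type)
  : Type := V.

Section RestrictL.
Variables (A B : pzRingType) (beta : {rmorphism A -> B}).
HB.instance Definition _ (V : zmodType) :=
  GRing.Zmodule.copy (resL beta V) V.

Section Left.
Variable V : lmodType B.
Let scale (a : A) (v : resL beta V) : resL beta V := beta a *: (v : V).
Fact resL_scalerA a b v : scale a (scale b v) = scale (a * b) v.
Proof. by rewrite /scale scalerA rmorphM. Qed.
Fact resL_scale1r : left_id 1 scale.
Proof. by move=> v; rewrite /scale rmorph1 scale1r. Qed.
Fact resL_scalerDr : right_distributive scale +%R.
Proof. by move=> a v w; exact: scalerDr. Qed.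
Fact resL_scalerDl v : {morph scale^~ v : a b / a + b}.
Proof. by move=> a b; rewrite /scale rmorphD; exact: scalerDl. Qed.
HB.instance Definition _ := GRing.Zmodule_isLmodule.Build A (resL beta V)
  resL_scalerA resL_scale1r resL_scalerDr resL_scalerDl.
End Left.

Section Right.
Variables (E : pzRingType) (V : rmodType E).
HB.instance Definition _ := Zmodule_isRmodule.Build E (resL beta V)
  (@ractA E V) (@ract1 E V) (@ractDl E V) (@ractDr E V).
End Right.

Section Both.
Variables (E : pzRingType) (V : bimodType B E).
Fact resL_lractA (a : A) (v : resL beta V) (b : E) :
  (a *: v) *> b = a *: (v *> b).
Proof. exact: (@lractA B E V). Qed.
HB.instance Definition _ := isBimodule.Build A E (resL beta V) resL_lractA.
End Both.
End RestrictL.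

Section RestrictR.
Variables (A B : pzRingType) (beta : {rmorphism A -> B}).
HB.instance Definition _ (V : zmodType) :=
  GRing.Zmodule.copy (resR beta V) V.

Section Right.
Variable V : rmodType B.
Let act (v : resR beta V) (a : A) : resR beta V := (v : V) *> beta a.
Fact resR_ractA v a b : act (act v a) b = act v (a * b).
Proof. by rewrite /act ractA rmorphM. Qed.
Fact resR_ract1 v : act v 1 = v.
Proof. by rewrite /act rmorph1 ract1. Qed.
Fact resR_ractDl v w a : act (v + w) a = act v a + act w a.
Proof. exact: ractDl. Qed.
Fact resR_ractDr v a b : act v (a + b) = act v a + act v b.
Proof. by rewrite /act rmorphD ractDr. Qed.
HB.instance Definition _ := Zmodule_isRmodule.Build A (resR beta V)
  resR_ractA resR_ract1 resR_ractDl resR_ractDr.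
End Right.

Section Left.
Variables (E : pzRingType) (V : lmodType E).
HB.instance Definition _ := GRing.Zmodule_isLmodule.Build E (resR beta V)
  (@scalerA E V) (@scale1r E V) (@scalerDr E V) (@scalerDl E V).
End Left.

Section Both.
Variables (E : pzRingType) (V : bimodType E B).
Fact resR_lractA (a : E) (v : resR beta V) (b : A) :
  (a *: v) *> b = a *: (v *> b).
Proof. exact: (@lractA E B V). Qed.
HB.instance Definition _ := isBimodule.Build E A (resR beta V) resR_lractA.
End Both.
End RestrictR.

Record rhom (A : pzRingType) (V W : rmodType A) := RHom {
  rhom_fun :> V -> W;
  rhomD : forall v w, rhom_fun (v + w) = rhom_fun v + rhom_fun w;
  rhomA : forall v a, rhom_fun (v *> a) = rhom_fun v *> a
}.

Lemma rhomP (A : pzRingType) (V W : rmodType A) (f g : rhom V W) :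
  f =1 g -> f = g.
Proof.
case: f g => [f fD fA] [g gD gA] /= /funext fg; subst g.
by rewrite (Prop_irrelevance fD gD) (Prop_irrelevance fA gA).
Qed.

Lemma linearP_eq (A : pzRingType) (V : lmodType A) (W : zmodType)
    (s : A -> W -> W) (f g : {linear V -> W | s}) : f =1 g -> f = g.
Proof.
case: f g => [f [[fD] [fZ]]] [g [[gD] [gZ]]] /= /funext fg; subst g.
by rewrite (Prop_irrelevance fD gD) (Prop_irrelevance fZ gZ).
Qed.

(* Lists of pairs stand for formal sums of pure tensors; teq is the least
   congruence that makes concatenation commutative and the pure tensors
   biadditive and A-balanced. *)
Inductive teq (A : pzRingType) (M : rmodType A) (N : lmodType A)
  : seq (M * N) -> seq (M * N) -> Prop :=
| teq_refl s : teq s s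
| teq_sym s t : teq s t -> teq t s
| teq_trans s t u : teq s t -> teq t u -> teq s u
| teq_cat s s' t t' : teq s s' -> teq t t' -> teq (s ++ t) (s' ++ t')
| teq_comm s t : teq (s ++ t) (t ++ s)
| teq_0l n : teq [:: (0, n)] [::]
| teq_Dl m m' n : teq [:: (m + m', n)] [:: (m, n); (m', n)]
| teq_Dr m n n' : teq [:: (m, n + n')] [:: (m, n); (m, n')]
| teq_bal m (a : A) n : teq [:: (m *> a, n)] [:: (m, a *: n)].

Arguments teq_refl {A M N}.

Section TensorDef.
Variables (A : pzRingType) (M : rmodType A) (N : lmodType A).

Let teqb (s t : seq (M * N)) : bool := `[< teq s t >].
Fact teqb_refl : reflexive teqb.
Proof. by move=> s; apply/asboolP; exact: teq_refl. Qed.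
Fact teqb_sym : symmetric teqb.
Proof.
by move=> s t; apply/idP/idP => /asboolP st; apply/asboolP; exact: teq_sym.
Qed.
Fact teqb_trans : transitive teqb.
Proof.
move=> s t u /asboolP ts /asboolP su; apply/asboolP; exact: teq_trans ts su.
Qed.
Definition teq_equiv := EquivRel teqb teqb_refl teqb_sym teqb_trans.

Definition tensor : Type := {eq_quot teq_equiv}.
HB.instance Definition _ := Choice.on tensor.
HB.instance Definition _ : EqQuotient _ teq_equiv tensor :=
  EqQuotient.on tensor.

Definition tcls (s : seq (M * N)) : tensor := \pi_tensor s.
Definition tens (m : M) (n : N) : tensor := tcls [:: (m, n)].

Lemma tclsP s t : tcls s = tcls t <-> teq s t.
Proof.
split=> [/eqP|st]; first by rewrite eqmodE => /asboolP.
by apply/eqP; rewrite eqmodE; apply/asboolP.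
Qed.

Lemma tcls_repr u : tcls (repr u) = u.
Proof. exact: reprK. Qed.

Lemma teq_repr s : teq (repr (tcls s)) s.
Proof. by apply/tclsP; rewrite tcls_repr. Qed.

Definition tadd (u v : tensor) := tcls (repr u ++ repr v).
Definition topp (u : tensor) := tcls [seq (- p.1, p.2) | p <- repr u].

Lemma tadd_of s t : tadd (tcls s) (tcls t) = tcls (s ++ t).
Proof. by apply/tclsP; apply: teq_cat; exact: teq_repr. Qed.

End TensorDef.

Lemma teq_map A (M : rmodType A) (N : lmodType A)
    A' (M' : rmodType A') (N' : lmodType A')
    (f : M -> M') (g : N -> N') :
    {morph f : x y / x + y} -> {morph g : x y / x + y} ->
    (forall m a n, teq [:: (f (m *> a), g n)] [:: (f m, g (a *: n))]) ->
  forall s t, teq s t ->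
    teq [seq (f p.1, g p.2) | p <- s] [seq (f p.1, g p.2) | p <- t].
Proof.
move=> fD gD bal s t; elim=> {s t} /=.
- by move=> s; exact: teq_refl.
- by move=> s t _; exact: teq_sym.
- by move=> s t u _ st _; exact: teq_trans st.
- by move=> s s' t t' _ ss' _ tt'; rewrite !map_cat; exact: teq_cat.
- by move=> s t; rewrite !map_cat; exact: teq_comm.
- move=> n; suff -> : f 0 = 0 by exact: teq_0l.
  by apply: (@addrI _ (f 0)); rewrite -fD !addr0.
- by move=> m m' n; rewrite fD; exact: teq_Dl.
- by move=> m n n'; rewrite gD; exact: teq_Dr.
- exact: bal.
Qed.

Section TensorZmod.
Variables (A : pzRingType) (M : rmodType A) (N : lmodType A).
Local Notation T := (tensor M N).
Local Notation tcls := (@tcls A M N).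
Implicit Types (u v w : T).

Lemma tsum_map (f : M -> M) : {morph f : x y / x + y} ->
    (forall m a, f (m *> a) = f m *> a) ->
  forall s, tcls [seq (f p.1, p.2) | p <- repr (tcls s)] =
    tcls [seq (f p.1, p.2) | p <- s].
Proof.
move=> fD fA s; apply/tclsP.
apply: (@teq_map _ _ _ _ _ _ f id) => //; last exact: teq_repr.
by move=> m a n; rewrite fA; exact: teq_bal.
Qed.

Fact taddA : associative (@tadd A M N).
Proof.
move=> u v w; rewrite -[u]tcls_repr -[v]tcls_repr -[w]tcls_repr.
by rewrite !tadd_of catA.
Qed.
Fact taddC : commutative (@tadd A M N).
Proof. by move=> u v; apply/tclsP; exact: teq_comm. Qed.
Fact tadd0 : left_id (tcls [::]) (@tadd A M N).
Proof. by move=> u; rewrite -[u]tcls_repr tadd_of. Qed.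
Fact taddN : left_inverse (tcls [::]) (@topp A M N) (@tadd A M N).
Proof.
move=> u; rewrite /topp -{2}[u]tcls_repr tadd_of.
elim: (repr u) => [//|[m n] s IH] /=.
rewrite -cat1s -[(m, n) :: s]cat1s -!tadd_of.
rewrite [tadd _ (tadd _ (tcls s))]taddA [tadd _ (tcls [:: (m, n)])]taddC.
rewrite -taddA [tadd (tcls _) (tcls s)]tadd_of IH taddA [tadd _ (tcls [::])]taddC.
rewrite tadd0 tadd_of; apply/tclsP.
apply: teq_trans (teq_0l _ n); apply: teq_sym.
by rewrite -[X in (X, n)](addNr m); exact: teq_Dl.
Qed.
HB.instance Definition _ := GRing.isZmodule.Build T taddA taddC tadd0 taddN.

Lemma tcls_cat s t : tcls (s ++ t) = tcls s + tcls t.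
Proof. by rewrite -tadd_of. Qed.

Lemma tclsE s : tcls s = \sum_(p <- s) tens p.1 p.2.
Proof.
elim: s => [|[m n] s IH]; first by rewrite big_nil.
by rewrite big_cons -IH -tcls_cat.
Qed.

Lemma tensDl m m' (n : N) : tens (m + m') n = tens m n + tens m' n :> T.
Proof. by rewrite -tcls_cat; apply/tclsP; exact: teq_Dl. Qed.
Lemma tensDr (m : M) n n' : tens m (n + n') = tens m n + tens m n' :> T.
Proof. by rewrite -tcls_cat; apply/tclsP; exact: teq_Dr. Qed.
Lemma tens_bal (m : M) a (n : N) : tens (m *> a) n = tens m (a *: n).
Proof. by apply/tclsP; exact: teq_bal. Qed.

Lemma tens0l (n : N) : tens (0 : M) n = 0.
Proof. by apply/tclsP; exact: teq_0l. Qed.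
Lemma tens0r (m : M) : tens m (0 : N) = 0.
Proof. by apply: (@addrI _ (tens m 0)); rewrite -tensDr !addr0. Qed.

Lemma tens_suml I (r : seq I) (P : pred I) (F : I -> M) (n : N) :
  tens (\sum_(i <- r | P i) F i) n = \sum_(i <- r | P i) tens (F i) n.
Proof.
apply: (big_morph (fun m => tens m n)); last exact: tens0l.
by move=> m m'; exact: tensDl.
Qed.
Lemma tens_sumr I (r : seq I) (P : pred I) (m : M) (F : I -> N) :
  tens m (\sum_(i <- r | P i) F i) = \sum_(i <- r | P i) tens m (F i).
Proof.
apply: (big_morph (fun n => tens m n)); last exact: tens0r.
by move=> n n'; exact: tensDr.
Qed.

Lemma tensorE u : u = \sum_(p <- repr u) tens p.1 p.2.
Proof. by rewrite -tclsE tcls_repr. Qed.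

Lemma tensor_ind (P : T -> Prop) :
    P 0 -> (forall m n, P (tens m n)) ->
    (forall u v, P u -> P v -> P (u + v)) -> forall u, P u.
Proof.
move=> P0 Pt PD u; rewrite [u]tensorE; elim: (repr u) => [|p s IH].
  by rewrite big_nil.
by rewrite big_cons; exact: PD.
Qed.

End TensorZmod.

(* tsum f (\sum m_i (x) n_i) = \sum f m_i n_i, computed on a chosen
   representative; this is the map induced by f when f is biadditive and
   balanced (lemma tsum_tens). *)
Definition tsum (A : pzRingType) (M : rmodType A) (N : lmodType A)
    (G : zmodType) (f : M -> N -> G) (u : tensor M N) : G :=
  \sum_(p <- repr u) f p.1 p.2.

Record balanced (A : pzRingType) (M : rmodType A) (N : lmodType A)
    (G : zmodType) (f : M -> N -> G) : Prop := Balanced {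
  balDl : forall m m' n, f (m + m') n = f m n + f m' n;
  balDr : forall m n n', f m (n + n') = f m n + f m n';
  balA : forall m a n, f (m *> a) n = f m (a *: n)
}.

Section TensorLift.
Variables (A : pzRingType) (M : rmodType A) (N : lmodType A) (G : zmodType).
Variables (f : M -> N -> G) (fP : balanced f).

Lemma teq_sum s t : teq s t ->
  \sum_(p <- s) f p.1 p.2 = \sum_(p <- t) f p.1 p.2.
Proof.
elim=> {s t} /=.
- by [].
- by [].
- by move=> s t u _ -> _ ->.
- by move=> s s' t t' _ ss' _ tt'; rewrite !big_cat /= ss' tt'.
- by move=> s t; rewrite !big_cat /= addrC.
- move=> n; rewrite big_seq1 big_nil /=.
  by apply: (@addrI _ (f 0 n)); rewrite -(balDl fP) !addr0.
- by move=> m m' n; rewrite !(big_cons, big_nil) /= (balDl fP) !addr0.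
- by move=> m n n'; rewrite !(big_cons, big_nil) /= (balDr fP) !addr0.
- by move=> m a n; rewrite !big_seq1 /= (balA fP).
Qed.

Lemma tsum_tcls s : tsum f (tcls s) = \sum_(p <- s) f p.1 p.2.
Proof. by apply: teq_sum; exact: teq_repr. Qed.

Lemma tsum_tens m n : tsum f (tens m n) = f m n.
Proof. by rewrite tsum_tcls big_seq1. Qed.

Lemma tsumD u v : tsum f (u + v) = tsum f u + tsum f v.
Proof. by rewrite tsum_tcls big_cat. Qed.

Lemma tsum0 : tsum f 0 = 0.
Proof. by apply: (@addrI _ (tsum f 0)); rewrite -tsumD !addr0. Qed.

Lemma tsumN u : tsum f (- u) = - tsum f u.
Proof. by apply: (@addrI _ (tsum f u)); rewrite -tsumD !subrr tsum0. Qed.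
End TensorLift.

Lemma tensor_ext (A : pzRingType) (M : rmodType A) (N : lmodType A)
    (G : zmodType) (f g : tensor M N -> G) :
    {morph f : x y / x + y} -> {morph g : x y / x + y} ->
  (forall m n, f (tens m n) = g (tens m n)) -> f =1 g.
Proof.
move=> fD gD fg; apply: tensor_ind => [|//|u v fgu fgv]; last first.
  by rewrite fD gD fgu fgv.
have h0 (h : tensor M N -> G) : {morph h : x y / x + y} -> h 0 = 0.
  by move=> hD; apply: (@addrI _ (h 0)); rewrite -hD !addr0.
by rewrite !h0.
Qed.

Lemma tsum_morph (A : pzRingType) (M : rmodType A) (N : lmodType A)
    (G H : zmodType) (f : M -> N -> G) (h : G -> H) u :
    h 0 = 0 -> {morph h : x y / x + y} ->
  h (tsum f u) = tsum (fun m n => h (f m n)) u.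
Proof. by move=> h0 hD; rewrite /tsum (big_morph h hD h0). Qed.

Lemma eq_tsum (A : pzRingType) (M : rmodType A) (N : lmodType A)
    (G : zmodType) (f g : M -> N -> G) u : f =2 g -> tsum f u = tsum g u.
Proof. by move=> fg; apply: eq_bigr => p _; exact: fg. Qed.

Section TensorRight.
Variables (A B : pzRingType) (M : rmodType A) (N : bimodType A B).
Local Notation T := (tensor M N).

Definition tract (u : T) (b : B) : T := tsum (fun m n => tens m (n *> b)) u.

Fact tract_bal b : balanced (fun (m : M) (n : N) => tens m (n *> b) : T).
Proof.
split=> [m m' n|m n n'|m a n]; first exact: tensDl.
- by rewrite ractDl tensDr.
- by rewrite tens_bal lractA.
Qed.

Lemma tract_tens m (n : N) b : tract (tens m n) b = tens m (n *> b).
Proof. exact: (tsum_tens (tract_bal b)). Qed.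
Lemma tractDl u v b : tract (u + v) b = tract u b + tract v b.
Proof. exact: (tsumD (tract_bal b)). Qed.
Fact tractA u a b : tract (tract u a) b = tract u (a * b).
Proof.
apply: (tensor_ext (f := fun u => tract (tract u a) b) (g := tract^~ _)).
- by move=> x y; rewrite !tractDl.
- by move=> x y; rewrite !tractDl.
- by move=> m n; rewrite !tract_tens ractA.
Qed.
Fact tract1 u : tract u 1 = u.
Proof.
apply: (tensor_ext (f := tract^~ 1) (g := id)) => //.
- by move=> x y; rewrite !tractDl.
- by move=> m n; rewrite !tract_tens ract1.
Qed.
Fact tractDr u a b : tract u (a + b) = tract u a + tract u b.
Proof.
apply: (tensor_ext (f := tract^~ _) (g := fun u => tract u a + tract u b)).
- by move=> x y; rewrite !tractDl.
- by move=> x y; rewrite !tractDl addrACA.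
- by move=> m n; rewrite !tract_tens ractDr tensDr.
Qed.
HB.instance Definition _ := Zmodule_isRmodule.Build B T
  tractA tract1 tractDl tractDr.

Lemma tens_ract m (n : N) b : (tens m n : T) *> b = tens m (n *> b).
Proof. exact: tract_tens. Qed.
End TensorRight.

Section TensorLeft.
Variables (A B : pzRingType) (M : bimodType B A) (N : lmodType A).
Local Notation T := (tensor M N).

Definition tlact (b : B) (u : T) : T := tsum (fun m n => tens (b *: m) n) u.

Fact tlact_bal b : balanced (fun (m : M) (n : N) => tens (b *: m) n : T).
Proof.
split=> [m m' n|m n n'|m a n]; last by rewrite -lractA tens_bal.
- by rewrite scalerDr tensDl.
- by rewrite tensDr.
Qed.

Lemma tlact_tens (m : M) (n : N) b : tlact b (tens m n) = tens (b *: m) n.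
Proof. exact: (tsum_tens (tlact_bal b)). Qed.
Fact tlactDr : right_distributive tlact +%R.
Proof. move=> b u v; exact: (tsumD (tlact_bal b)). Qed.
Fact tlactA a b u : tlact a (tlact b u) = tlact (a * b) u.
Proof.
apply: (tensor_ext (f := fun u => tlact a (tlact b u)) (g := tlact _)).
- by move=> x y; rewrite !tlactDr.
- by move=> x y; rewrite !tlactDr.
- by move=> m n; rewrite !tlact_tens scalerA.
Qed.
Fact tlact1 : left_id 1 tlact.
Proof.
apply: (tensor_ext (f := tlact 1) (g := id)) => //.
- by move=> x y; rewrite !tlactDr.
- by move=> m n; rewrite !tlact_tens scale1r.
Qed.
Fact tlactDl u : {morph tlact^~ u : a b / a + b}.
Proof.
move=> a b.
apply: (tensor_ext (f := tlact _) (g := fun u => tlact a u + tlact b u)).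
- by move=> x y; rewrite !tlactDr.
- by move=> x y; rewrite !tlactDr addrACA.
- by move=> m n; rewrite !tlact_tens scalerDl tensDl.
Qed.
HB.instance Definition _ := GRing.Zmodule_isLmodule.Build B T
  tlactA tlact1 tlactDr tlactDl.

Lemma tens_scale (m : M) (n : N) b : b *: (tens m n : T) = tens (b *: m) n.
Proof. exact: tlact_tens. Qed.
End TensorLeft.

Section TensorBimod.
Variables (A B E : pzRingType) (M : bimodType B A) (N : bimodType A E).
Fact tensor_lractA (b : B) (u : tensor M N) (e : E) :
  (b *: u) *> e = b *: (u *> e).
Proof.
apply: (tensor_ext (f := fun u => (b *: u) *> e)
  (g := fun u : tensor M N => b *: (u *> e))).
- by move=> x y; rewrite scalerDr ractDl.
- by move=> x y; rewrite ractDl scalerDr.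
- by move=> m n; rewrite tens_scale !tens_ract tens_scale.
Qed.
HB.instance Definition _ := isBimodule.Build B E (tensor M N) tensor_lractA.
End TensorBimod.

Definition tmap (A : pzRingType) (M M' : rmodType A) (N N' : lmodType A)
    (f : M -> M') (g : N -> N') : tensor M N -> tensor M' N' :=
  tsum (fun m n => tens (f m) (g n)).

Definition tassoc (A B : pzRingType) (M : rmodType A) (N : bimodType A B)
    (P : lmodType B) : tensor (tensor M N) P -> tensor M (tensor N P) :=
  tsum (fun u p => tsum (fun m n => tens m (tens n p)) u).

Section TmapTheory.
Variables (A : pzRingType) (M M' : rmodType A) (N N' : lmodType A).
Variables (f : M -> M') (g : N -> N').
Hypothesis fD : forall x y, f (x + y) = f x + f y.
Hypothesis fA : forall x a, f (x *> a) = f x *> a.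
Hypothesis gD : forall x y, g (x + y) = g x + g y.
Hypothesis gA : forall (a : A) x, g (a *: x) = a *: g x.

Lemma tmap_bal : balanced (fun m n => tens (f m) (g n)).
Proof.
split=> [m m' n|m n n'|m a n]; first by rewrite fD tensDl.
- by rewrite gD tensDr.
- by rewrite fA gA tens_bal.
Qed.

Lemma tmap_tens m n : tmap f g (tens m n) = tens (f m) (g n).
Proof. exact: (tsum_tens tmap_bal). Qed.
Lemma tmapD u v : tmap f g (u + v) = tmap f g u + tmap f g v.
Proof. exact: (tsumD tmap_bal). Qed.
Lemma tmap0 : tmap f g 0 = 0.
Proof. exact: (tsum0 tmap_bal). Qed.
End TmapTheory.

Section TassocTheory.
Variables (A B : pzRingType) (M : rmodType A) (N : bimodType A B).
Variable (P : lmodType B).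

Fact tassoc_bal1 (p : P) :
  balanced (fun (m : M) (n : N) => tens m (tens n p)).
Proof.
split=> [m m' n|m n n'|m a n]; first by rewrite tensDl.
- by rewrite tensDl tensDr.
- by rewrite tens_bal tens_scale.
Qed.

Fact tassoc_bal : balanced (fun (u : tensor M N) (p : P) =>
  tsum (fun m n => tens m (tens n p)) u).
Proof.
split=> [u v p|u p p'|u b p]; first exact: (tsumD (tassoc_bal1 _)).
- apply: (tensor_ext (f := tsum _)
    (g := fun u => tsum (fun m n => tens m (tens n p)) u +
                   tsum (fun m n => tens m (tens n p')) u)).
  + exact: (tsumD (tassoc_bal1 _)).
  + by move=> x y; rewrite !(tsumD (tassoc_bal1 _)) addrACA.
  + by move=> m n; rewrite !(tsum_tens (tassoc_bal1 _)) !tensDr.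
- apply: (tensor_ext (f := fun u => tsum _ (u *> b)) (g := tsum _)).
  + by move=> x y; rewrite ractDl (tsumD (tassoc_bal1 _)).
  + exact: (tsumD (tassoc_bal1 _)).
  + by move=> m n; rewrite tens_ract !(tsum_tens (tassoc_bal1 _)) tens_bal.
Qed.

Lemma tassoc_tens (m : M) (n : N) (p : P) :
  tassoc (tens (tens m n) p) = tens m (tens n p).
Proof. by rewrite /tassoc (tsum_tens tassoc_bal) (tsum_tens (tassoc_bal1 _)). Qed.

Lemma tassocD : {morph @tassoc A B M N P : u v / u + v}.
Proof. exact: (tsumD tassoc_bal). Qed.
End TassocTheory.

(* Sigma x_i f(c_i) *)
Definition contr (A : pzRingType) (M : rmodType A) (N : lmodType A)
  (f : N -> A) (u : tensor M N) : M := tsum (fun m n => m *> f n) u.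

Section ContrTheory.
Variables (A : pzRingType) (M : rmodType A) (N : lmodType A).

Section OneForm.
Variable f : {linear N -> A | *%R}.

Lemma contr_bal : balanced (fun (m : M) (n : N) => m *> f n).
Proof.
split=> [m m' n|m n n'|m a n]; first exact: ractDl.
- by rewrite linearD ractDr.
- by rewrite linearZ ractA.
Qed.

Lemma contr_tens (m : M) n : contr f (tens m n) = m *> f n.
Proof. exact: (tsum_tens contr_bal). Qed.
Lemma contrD : {morph @contr A M N f : u v / u + v}.
Proof. exact: (tsumD contr_bal). Qed.
Lemma contr0 : @contr A M N f 0 = 0.
Proof. exact: (tsum0 contr_bal). Qed.
Lemma contrN : {morph @contr A M N f : u / - u}.
Proof. exact: (tsumN contr_bal). Qed.
End OneForm.

Lemma eq_contr (f g : N -> A) (u : tensor M N) :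
  f =1 g -> contr f u = contr g u.
Proof. by move=> fg; apply: eq_tsum => m n; rewrite fg. Qed.

End ContrTheory.

Lemma contr_tmap (A : pzRingType) (M M' : rmodType A) (N N' : lmodType A)
    (h : M -> M') (k : N -> N') (f : {linear N' -> A | *%R})
    (g : {linear N -> A | *%R}) :
    (forall x y, h (x + y) = h x + h y) ->
    (forall x a, h (x *> a) = h x *> a) ->
    (forall x y, k (x + y) = k x + k y) ->
    (forall (a : A) x, k (a *: x) = a *: k x) ->
    (forall n, f (k n) = g n) ->
  forall u, contr f (tmap h k u) = h (contr g u).
Proof.
move=> hD hA kD kA fg.
apply: (tensor_ext (f := fun u => contr f (tmap h k u))
  (g := fun u => h (contr g u))).
- by move=> u v; rewrite tmapD // contrD.
- by move=> u v; rewrite contrD hD.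
- by move=> m n; rewrite tmap_tens // !contr_tens hA fg.
Qed.

Record coring (A : pzRingType) := Coring {
  coring_sort :> bimodType A A;
  comul : coring_sort -> tensor coring_sort coring_sort;
  counit : coring_sort -> A;
  comulD : forall c d, comul (c + d) = comul c + comul d;
  comulZ : forall (a : A) c, comul (a *: c) = a *: comul c;
  comul_ract : forall c (a : A), comul (c *> a) = comul c *> a;
  counitD : forall c d, counit (c + d) = counit c + counit d;
  counitZ : forall a c, counit (a *: c) = a * counit c;
  counit_ract : forall c a, counit (c *> a) = counit c * a;
  comulA : forall c, tassoc (tmap comul id (comul c)) = tmap id comul (comul c);
  counitl : forall c, tsum (fun c1 c2 => counit c1 *: c2) (comul c) = c;
  counitr : forall c, tsum (fun c1 c2 => c1 *> counit c2) (comul c) = c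
}.

Record comodule (A : pzRingType) (C : coring A) := Comodule {
  comodule_sort :> rmodType A;
  coact : comodule_sort -> tensor comodule_sort C;
  coactD : forall m n, coact (m + n) = coact m + coact n;
  coact_ract : forall m a, coact (m *> a) = coact m *> a;
  coactA : forall m,
    tassoc (tmap coact id (coact m)) = tmap id (@comul A C) (coact m);
  coact_counit : forall m,
    tsum (fun m0 m1 => m0 *> counit m1) (coact m) = m
}.

Record comod_hom (A : pzRingType) (C : coring A) (M N : comodule C) :=
  ComodHom {
    comod_rhom :> rhom M N;
    comod_homP : forall m, coact (comod_rhom m) = tmap comod_rhom id (coact m)
  }.

Lemma comod_hom_eq (A : pzRingType) (C : coring A) (M N : comodule C)
  (f g : comod_hom M N) : f =1 g -> f = g.
Proof.
case: f g => [f fP] [g gP] /= /rhomP fg; subst g.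
by rewrite (Prop_irrelevance fP gP).
Qed.

Definition coring_comod (A : pzRingType) (C : coring A) : comodule C :=
  @Comodule A C C (@comul A C) (@comulD A C) (@comul_ract A C)
    (@comulA A C) (@counitr A C).

Definition mk_linear (R : pzRingType) (U : lmodType R) (V : zmodType)
    (s : GRing.Scale.law R V) (f : U -> V) (fP : linear_for s f)
  : {linear U -> V | s} := HB.pack f (GRing.isLinear.Build R U V s f fP).

Section LeftDual.
Variables (A : pzRingType) (C : coring A).

Definition ldual : Type := {linear C -> A | *%R}.
HB.instance Definition _ := gen_eqMixin ldual.
HB.instance Definition _ := gen_choiceMixin ldual.

Definition ldual_fun (f : ldual) : C -> A :=
  (f : {linear C -> A | *%R}) : C -> A.
Local Coercion ldual_fun : ldual >-> Funclass.

Implicit Types f g h : ldual.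

Lemma ldualP f g : f =1 g -> f = g.
Proof. exact: linearP_eq. Qed.
Lemma ldualD f c d : f (c + d) = f c + f d.
Proof. exact: (linearD (f : {linear C -> A | *%R})). Qed.
Lemma ldualZ f a c : f (a *: c) = a * f c.
Proof. exact: (linearZ_LR (f : {linear C -> A | *%R})). Qed.

Lemma ldual0 f : f 0 = 0.
Proof. by apply: (@addrI _ (f 0)); rewrite -ldualD !addr0. Qed.
Lemma ldual_tsum (E : pzRingType) (M : rmodType E) (N : lmodType E) f (F : M -> N -> C) u :
  f (tsum F u) = tsum (fun m n => f (F m n)) u.
Proof. by apply: (@tsum_morph _ _ _ _ _ _ f); [exact: ldual0|exact: ldualD]. Qed.

Fact ldual_zero_lin : linear_for (@GRing.mul A) (fun _ : C => 0).
Proof. by move=> a u v; rewrite mulr0 addr0. Qed.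
Fact ldual_add_lin f g : linear_for (@GRing.mul A) (fun c => f c + g c).
Proof. by move=> a u v; rewrite !ldualD !ldualZ mulrDr addrACA. Qed.
Fact ldual_opp_lin f : linear_for (@GRing.mul A) (fun c => - f c).
Proof. by move=> a u v; rewrite !ldualD !ldualZ opprD mulrN. Qed.
Definition ldual_zero : ldual := mk_linear ldual_zero_lin.
Definition ldual_add f g : ldual := mk_linear (ldual_add_lin f g).
Definition ldual_opp f : ldual := mk_linear (ldual_opp_lin f).

Fact ldual_addA : associative ldual_add.
Proof. by move=> f g h; apply: ldualP => c; exact: addrA. Qed.
Fact ldual_addC : commutative ldual_add.
Proof. by move=> f g; apply: ldualP => c; exact: addrC. Qed.
Fact ldual_add0 : left_id ldual_zero ldual_add.
Proof. by move=> f; apply: ldualP => c; exact: add0r. Qed.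
Fact ldual_addN : left_inverse ldual_zero ldual_opp ldual_add.
Proof. by move=> f; apply: ldualP => c; exact: addNr. Qed.
HB.instance Definition _ := GRing.isZmodule.Build ldual
  ldual_addA ldual_addC ldual_add0 ldual_addN.

(* m f = Sigma m_0 f(m_1) *)
Definition coact_star (M : comodule C) (m : M) (f : ldual) : M :=
  contr f (coact m).

Lemma contr_lcomod (f : ldual) (u : tensor C C) (a : A) :
  contr f (a *: u) = a *: contr f u.
Proof.
apply: (tensor_ext (f := fun u => contr f (a *: u))
  (g := fun u => a *: contr f u)).
- by move=> x y; rewrite scalerDr contrD.
- by move=> x y; rewrite contrD scalerDr.
- by move=> m n; rewrite tens_scale !contr_tens lractA.
Qed.

(* (f * g)(c) = Sigma g(c_1 f(c_2)) *)
Fact lstar_lin f g : linear_for (@GRing.mul A)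
  (fun c => tsum (fun c1 c2 => g (c1 *> f c2)) (comul c)).
Proof.
have E c : tsum (fun c1 c2 => g (c1 *> f c2)) (comul c) =
    g (contr f (comul c)).
  by rewrite ldual_tsum.
by move=> a c d; rewrite !E comulD comulZ contrD contr_lcomod ldualD ldualZ.
Qed.
Definition lstar f g : ldual := mk_linear (lstar_lin f g).

Lemma lstarE f g c : lstar f g c = g (contr f (comul c)).
Proof. by rewrite ldual_tsum. Qed.

Fact lone_lin : linear_for (@GRing.mul A) (@counit A C).
Proof. by move=> a c d; rewrite counitD counitZ. Qed.
Definition lone : ldual := mk_linear lone_lin.

Lemma contr_assoc (M : rmodType A) f g (u : tensor (tensor M C) C) :
  contr g (contr f u) = tsum (fun m v => m *> g (contr f v)) (tassoc u).
Proof.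
have bal : balanced (fun (m : M) (v : tensor C C) => m *> g (contr f v)).
  split=> [m m' v|m v v'|m a v]; first exact: ractDl.
  - by rewrite contrD ldualD ractDr.
  - by rewrite contr_lcomod ldualZ ractA.
apply: (tensor_ext (f := fun u => contr g (contr f u))
   (g := fun u => tsum _ (tassoc u))).
- by move=> x y; rewrite !contrD.
- by move=> x y; rewrite tassocD (tsumD bal).
move=> u' c; rewrite contr_tens.
apply: (tensor_ext (f := fun u' => contr g (u' *> f c))
   (g := fun u' => tsum _ (tassoc (tens u' c)))).
- by move=> x y; rewrite ractDl contrD.
- by move=> x y; rewrite tensDl tassocD (tsumD bal).
- move=> m n.
  by rewrite tens_ract contr_tens tassoc_tens (tsum_tens bal) contr_tens.
Qed.

Lemma coact_starA (M : comodule C) (m : M) f g :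
  coact_star (coact_star m f) g = coact_star m (lstar f g).
Proof.
rewrite /coact_star.
have E (u : tensor M C) : coact (contr f u) = contr f (tmap (@coact A C M) id u).
  apply: (tensor_ext (f := fun u => coact (contr f u))
    (g := fun u => contr f (tmap (@coact A C M) id u))).
  - by move=> x y; rewrite contrD coactD.
  - by move=> x y; rewrite tmapD ?contrD //;
      [exact: coactD|exact: coact_ract].
  - move=> n c; rewrite tmap_tens //; try exact: coactD; try exact: coact_ract.
    by rewrite !contr_tens coact_ract.
rewrite E contr_assoc coactA.
have bal : balanced (fun (m : M) (v : tensor C C) => m *> g (contr f v)).
  split=> [x y v|x v v'|x a v]; first exact: ractDl.
  - by rewrite contrD ldualD ractDr.
  - by rewrite contr_lcomod ldualZ ractA.
apply: (tensor_ext (f := fun u => tsum _ (tmap id (@comul A C) u))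
  (g := contr (lstar f g))).
- by move=> x y; rewrite tmapD ?(tsumD bal) //;
    [exact: comulD|exact: comulZ].
- exact: contrD.
- move=> n c; rewrite tmap_tens //; try exact: comulD; try exact: comulZ.
  rewrite (tsum_tens bal) contr_tens; congr (n *> _).
  by symmetry; exact: lstarE.
Qed.

Lemma coact_star1 (M : comodule C) (m : M) : coact_star m lone = m.
Proof. exact: coact_counit. Qed.

Lemma coact_starDl (M : comodule C) (m n : M) f :
  coact_star (m + n) f = coact_star m f + coact_star n f.
Proof. by rewrite /coact_star coactD contrD. Qed.

Lemma contrDf (M : rmodType A) (u : tensor M C) f g :
  contr (ldual_add f g) u = contr f u + contr g u.
Proof.
rewrite /contr /tsum -big_split /=; apply: eq_bigr => p _.
by rewrite -ractDr.
Qed.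

Lemma coact_starDr (M : comodule C) (m : M) f g :
  coact_star m (f + g) = coact_star m f + coact_star m g.
Proof. exact: contrDf. Qed.

Lemma lstarE' f g c : lstar f g c = g (coact_star (c : coring_comod C) f).
Proof. exact: lstarE. Qed.

Fact lstarA : associative lstar.
Proof.
move=> f g h; apply: ldualP => c.
by rewrite !lstarE' -(@coact_starA (coring_comod C)).
Qed.
Fact lstar1l : left_id lone lstar.
Proof. by move=> f; apply: ldualP => c; rewrite lstarE' coact_star1. Qed.
Fact lstar1r : right_id lone lstar.
Proof.
move=> f; apply: ldualP => c; rewrite lstarE /=.
transitivity (f (tsum (fun c1 c2 => counit c1 *: c2) (comul c))).
  rewrite /contr [LHS](ldual_tsum lone) ldual_tsum.
  by apply: eq_tsum => c1 c2; rewrite ldualZ -counit_ract.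
by rewrite counitl.
Qed.
Fact lstarDl : left_distributive lstar +%R.
Proof.
move=> f g h; apply: ldualP => c; rewrite lstarE'.
rewrite [RHS]/(lstar f h c + lstar g h c).
by rewrite !lstarE' coact_starDr; exact: ldualD.
Qed.
Fact lstarDr : right_distributive lstar +%R.
Proof.
move=> f g h; apply: ldualP => c; rewrite lstarE'.
by rewrite [RHS]/(lstar f g c + lstar f h c) !lstarE'.
Qed.
HB.instance Definition _ := GRing.Zmodule_isPzRing.Build ldual
  lstarA lstar1l lstar1r lstarDl lstarDr.

(* A -> *C, a |-> eps(-) a; right *C-modules are right A-modules along it. *)
Fact ldual_of_lin (a : A) : linear_for (@GRing.mul A) (fun c : C => counit c * a).
Proof. by move=> b c d; rewrite counitD counitZ mulrDl mulrA. Qed.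
Definition ldual_of (a : A) : ldual := mk_linear (ldual_of_lin a).

Fact ldual_of_zmod : zmod_morphism ldual_of.
Proof. by move=> a b; apply: ldualP => c; exact: mulrBr. Qed.
Fact ldual_of_monoid : monoid_morphism ldual_of.
Proof.
split=> [|a b]; apply: ldualP => c; first exact: mulr1.
rewrite [RHS]lstarE [LHS]/(counit c * (a * b)).
transitivity (counit (contr lone (comul c) *> a) * b); last first.
  congr (counit _ * b); rewrite /contr (@tsum_morph _ _ _ _ _ _ (ract^~ a));
    [|exact: ract0l|by move=> x y; exact: ractDl].
  by apply: eq_tsum => c1 c2; rewrite ractA.
rewrite [contr _ _](@coact_star1 (coring_comod C)) counit_ract; exact: mulrA.
Qed.
HB.instance Definition _ := GRing.isZmodMorphism.Build A ldual ldual_of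
  ldual_of_zmod.
HB.instance Definition _ := GRing.isMonoidMorphism.Build A ldual ldual_of
  ldual_of_monoid.

End LeftDual.

Coercion ldual_fun : ldual >-> Funclass.

Definition comod_star (A : pzRingType) (C : coring A) (M : comodule C) : Type :=
  M.

Section ComodStar.
Variables (A : pzRingType) (C : coring A) (M : comodule C).
HB.instance Definition _ := GRing.Zmodule.copy (comod_star M) M.
HB.instance Definition _ := Zmodule_isRmodule.Build (ldual C) (comod_star M)
  (@coact_starA A C M) (@coact_star1 A C M)
  (@coact_starDl A C M) (@coact_starDr A C M).
End ComodStar.

Definition chi (A B : pzRingType) (beta : {rmorphism A -> B})
    (D : bimodType B B) : tensor (resR beta D) (resL beta D) -> tensor D D :=
  @tsum A (resR beta D) (resL beta D) _ (fun d d' => @tens B D D d d').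

Record coring_hom (A B : pzRingType) (beta : {rmorphism A -> B})
    (C : coring A) (D : coring B) := CoringHom {
  theta :> C -> D;
  thetaD : forall c d, theta (c + d) = theta c + theta d;
  thetaZ : forall a c, theta (a *: c) = beta a *: theta c;
  theta_ract : forall c a, theta (c *> a) = theta c *> beta a;
  theta_comul : forall c,
    chi (@tmap A C (resR beta D) C (resL beta D) theta theta (comul c)) =
      comul (theta c);
  theta_counit : forall c, counit (theta c) = beta (counit c)
}.

Lemma tsum_tmap (A : pzRingType) (M M' : rmodType A) (N N' : lmodType A)
    (h : M -> M') (k : N -> N') (G : zmodType) (F : M' -> N' -> G) :
    (forall x y, h (x + y) = h x + h y) ->
    (forall x a, h (x *> a) = h x *> a) ->
    (forall x y, k (x + y) = k x + k y) ->
    (forall (a : A) x, k (a *: x) = a *: k x) ->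
    balanced F ->
  forall u, tsum F (tmap h k u) = tsum (fun m n => F (h m) (k n)) u.
Proof.
move=> hD hA kD kA FP.
have bal : balanced (fun m n => F (h m) (k n)).
  split=> [m m' n|m n n'|m a n]; first by rewrite hD (balDl FP).
  - by rewrite kD (balDr FP).
  - by rewrite hA kA (balA FP).
apply: (tensor_ext (f := fun u => tsum F (tmap h k u)) (g := tsum _)).
- by move=> u v; rewrite tmapD // (tsumD FP).
- exact: (tsumD bal).
- by move=> m n; rewrite tmap_tens // (tsum_tens FP) (tsum_tens bal).
Qed.

(* #C = Hom_{A-}(C, B), with B a left A-module through beta. The phantom
   argument th is what the right *D-action below depends on. *)
Definition sharp (A B : pzRingType) (beta : {rmorphism A -> B})
    (C : coring A) (D : coring B) (th : coring_hom beta C D) : Type :=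
  {linear C -> B | beta \; *%R}.

Section SharpDual.
Variables (A B : pzRingType) (beta : {rmorphism A -> B}).
Variables (C : coring A) (D : coring B) (th : coring_hom beta C D).

HB.instance Definition _ := gen_eqMixin (sharp th).
HB.instance Definition _ := gen_choiceMixin (sharp th).

Definition sharp_fun (h : sharp th) : C -> B :=
  (h : {linear C -> B | beta \; *%R}) : C -> B.
Local Coercion sharp_fun : sharp >-> Funclass.

Implicit Types h k : sharp th.

Lemma sharpP h k : h =1 k -> h = k.
Proof. exact: linearP_eq. Qed.
Lemma sharpD h c d : h (c + d) = h c + h d.
Proof. exact: (linearD (h : {linear C -> B | beta \; *%R})). Qed.
Lemma sharpZ h a c : h (a *: c) = beta a * h c.
Proof. exact: (linearZ_LR (h : {linear C -> B | beta \; *%R})). Qed.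
Lemma sharp0 h : h 0 = 0.
Proof. by apply: (@addrI _ (h 0)); rewrite -sharpD !addr0. Qed.
Lemma sharp_tsum (E : pzRingType) (M : rmodType E) (N : lmodType E) h
    (F : M -> N -> C) u :
  h (tsum F u) = tsum (fun m n => h (F m n)) u.
Proof. by apply: (@tsum_morph _ _ _ _ _ _ h); [exact: sharp0|exact: sharpD]. Qed.

Fact sharp_zero_lin : linear_for (beta \; @GRing.mul B) (fun _ : C => 0).
Proof. by move=> a u v /=; rewrite mulr0 addr0. Qed.
Fact sharp_add_lin h k : linear_for (beta \; @GRing.mul B) (fun c => h c + k c).
Proof. by move=> a u v /=; rewrite !sharpD !sharpZ mulrDr addrACA. Qed.
Fact sharp_opp_lin h : linear_for (beta \; @GRing.mul B) (fun c => - h c).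
Proof. by move=> a u v /=; rewrite !sharpD !sharpZ opprD mulrN. Qed.
Definition sharp_zero : sharp th := mk_linear sharp_zero_lin.
Definition sharp_add h k : sharp th := mk_linear (sharp_add_lin h k).
Definition sharp_opp h : sharp th := mk_linear (sharp_opp_lin h).

Fact sharp_addA : associative sharp_add.
Proof. by move=> f g h; apply: sharpP => c; exact: addrA. Qed.
Fact sharp_addC : commutative sharp_add.
Proof. by move=> f g; apply: sharpP => c; exact: addrC. Qed.
Fact sharp_add0 : left_id sharp_zero sharp_add.
Proof. by move=> f; apply: sharpP => c; exact: add0r. Qed.
Fact sharp_addN : left_inverse sharp_zero sharp_opp sharp_add.
Proof. by move=> f; apply: sharpP => c; exact: addNr. Qed.
HB.instance Definition _ := GRing.isZmodule.Build (sharp th)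
  sharp_addA sharp_addC sharp_add0 sharp_addN.

(* (phi -> h)(c) = Sigma h(c_1 phi(c_2)) *)
Fact hscale_lin (phi : ldual C) h : linear_for (beta \; @GRing.mul B)
  (fun c => tsum (fun c1 c2 => h (c1 *> phi c2)) (comul c)).
Proof.
have E c : tsum (fun c1 c2 => h (c1 *> phi c2)) (comul c) =
    h (contr phi (comul c)) by rewrite sharp_tsum.
move=> a c d; rewrite !E comulD comulZ contrD contr_lcomod.
by rewrite sharpD sharpZ.
Qed.
Definition hscale phi h : sharp th := mk_linear (hscale_lin phi h).

Lemma hscaleE phi h c :
  hscale phi h c = h (coact_star (c : coring_comod C) phi).
Proof. by rewrite sharp_tsum. Qed.

Fact hscaleA f g h : hscale f (hscale g h) = hscale (f * g) h.
Proof.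
by apply: sharpP => c; rewrite !hscaleE -(@coact_starA _ _ (coring_comod C)).
Qed.
Fact hscale1 : left_id 1 hscale.
Proof. by move=> h; apply: sharpP => c; rewrite hscaleE coact_star1. Qed.
Fact hscaleDr : right_distributive hscale +%R.
Proof.
move=> f h k; apply: sharpP => c.
by rewrite [RHS]/(hscale f h c + hscale f k c) !hscaleE.
Qed.
Fact hscaleDl h : {morph hscale^~ h : f g / f + g}.
Proof.
move=> f g; apply: sharpP => c.
rewrite [RHS]/(hscale f h c + hscale g h c) !hscaleE coact_starDr.
exact: sharpD.
Qed.
HB.instance Definition _ := GRing.Zmodule_isLmodule.Build (ldual C) (sharp th)
  hscaleA hscale1 hscaleDr hscaleDl.

(* c |-> Sigma theta(c_1) h(c_2) *)
Definition hcontr h (c : C) : D := tsum (fun c1 c2 => th c1 *> h c2) (comul c).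

Lemma hcontr_bal h : balanced (fun c1 c2 : C => th c1 *> h c2).
Proof.
split=> [c c' d|c d d'|c a d]; first by rewrite thetaD ractDl.
- by rewrite sharpD ractDr.
- by rewrite theta_ract sharpZ ractA.
Qed.

Lemma tsum_hcontrZ h (a : A) u :
  tsum (fun c1 c2 : C => th c1 *> h c2) (a *: u) =
  beta a *: tsum (fun c1 c2 : C => th c1 *> h c2) u.
Proof.
have bal := hcontr_bal h.
apply: (tensor_ext (f := fun u => tsum _ (a *: u))
  (g := fun u => beta a *: tsum _ u)).
- by move=> x y; rewrite scalerDr (tsumD bal).
- by move=> x y; rewrite (tsumD bal) scalerDr.
- by move=> c d; rewrite tens_scale !(tsum_tens bal) thetaZ lractA.
Qed.

Lemma hcontrD h c d : hcontr h (c + d) = hcontr h c + hcontr h d.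
Proof. by rewrite /hcontr comulD (tsumD (hcontr_bal h)). Qed.
Lemma hcontrZ h (a : A) c : hcontr h (a *: c) = beta a *: hcontr h c.
Proof. by rewrite /hcontr comulZ tsum_hcontrZ. Qed.

(* (h <- g)(c) = Sigma g(theta(c_1) h(c_2)) *)
Fact hract_lin h (g : ldual D) : linear_for (beta \; @GRing.mul B)
  (fun c => tsum (fun c1 c2 => g (th c1 *> h c2)) (comul c)).
Proof.
have E c : tsum (fun c1 c2 => g (th c1 *> h c2)) (comul c) =
    g (hcontr h c) by rewrite /hcontr ldual_tsum.
by move=> a c d; rewrite !E hcontrD hcontrZ ldualD ldualZ.
Qed.
Definition hract h g : sharp th := mk_linear (hract_lin h g).

Lemma hractE h g c : hract h g c = g (hcontr h c).
Proof. by rewrite /hcontr ldual_tsum. Qed.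

Lemma theta_comul_tsum (G : zmodType) (F : D -> D -> G) : balanced F ->
  forall c, tsum F (comul (th c)) = tsum (fun c1 c2 => F (th c1) (th c2)) (comul c).
Proof.
move=> FP c; rewrite -theta_comul /chi.
have tP : @balanced A (resR beta D) (resL beta D) _
    (fun d d' => @tens B D D d d').
  split=> [m m' n|m n n'|m a n]; first exact: tensDl.
  - exact: tensDr.
  - exact: tens_bal.
rewrite tsum_tmap //; try exact: thetaD; try exact: theta_ract;
  try exact: thetaZ.
rewrite (@tsum_morph _ _ _ _ _ _ (tsum F)); last exact: (tsumD FP).
  by apply: eq_tsum => c1 c2; rewrite (tsum_tens FP).
exact: (tsum0 FP).
Qed.

(* Sigma theta(c_1) (h <- g)(c_2) = (Sigma theta(c_1) h(c_2)) g *)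
Lemma hcontr_hract h g c :
  hcontr (hract h g) c = coact_star (hcontr h c : coring_comod D) g.
Proof.
pose S (v : tensor C C) : D := tsum (fun c1 c2 => th c1 *> h c2) v.
have balS : balanced (fun (m : C) (v : tensor C C) => th m *> g (S v)).
  split=> [m m' v|m v v'|m a v]; first by rewrite thetaD ractDl.
  - by rewrite /S (tsumD (hcontr_bal h)) ldualD ractDr.
  - by rewrite /S tsum_hcontrZ ldualZ theta_ract ractA.
have -> : hcontr (hract h g) c =
    tsum (fun m v => th m *> g (S v)) (tmap id (@comul A C) (comul c)).
  rewrite tsum_tmap //; try exact: comulD; try exact: comulZ.
  by apply: eq_tsum => c1 c2; rewrite hractE.
rewrite -comulA /hcontr.
have gD : forall d d' : coring_comod D,
    coact_star (d + d') g = coact_star d g + coact_star d' g.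
  by move=> d d'; exact: coact_starDl.
have g0 : coact_star (0 : coring_comod D) g = 0.
  by apply: (@addrI _ (coact_star (0 : coring_comod D) g)); rewrite -gD !addr0.
rewrite (@tsum_morph _ _ _ _ _ _ (fun d : D => coact_star (d : coring_comod D) g)) //.
have E1 c1 b : coact_star (th c1 *> b : coring_comod D) g =
    tsum (fun x y => th x *> g (th y *> b)) (comul c1).
  rewrite /coact_star /= comul_ract.
  have balb : balanced (fun x y : D => x *> g (y *> b)).
    split=> [m m' v|m v v'|m a v]; first exact: ractDl.
    - by rewrite ractDl ldualD ractDr.
    - by rewrite lractA ldualZ ractA.
  rewrite -(theta_comul_tsum balb).
  apply: (tensor_ext (f := fun u => contr g (u *> b)) (g := tsum _)).
  - by move=> x y; rewrite ractDl contrD.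
  - exact: (tsumD balb).
  - by move=> x y; rewrite tens_ract contr_tens (tsum_tens balb).
under [RHS]eq_tsum do rewrite E1.
have balz z : balanced (fun x y : C => th x *> g (th y *> h z)).
  split=> [m m' v|m v v'|m a v]; first by rewrite thetaD ractDl.
  - by rewrite thetaD ractDl ldualD ractDr.
  - by rewrite theta_ract thetaZ lractA ldualZ ractA.
have bal2 : balanced (fun (v : tensor C C) (z : C) =>
    tsum (fun x y => th x *> g (th y *> h z)) v).
  split=> [v v' z|v z z'|v a z]; first exact: (tsumD (balz z)).
  - rewrite /tsum -big_split /=; apply: eq_bigr => p _.
    by rewrite sharpD ractDr ldualD ractDr.
  - rewrite sharpZ.
    apply: (tensor_ext (f := fun v => tsum _ (v *> a)) (g := tsum _)).
    + by move=> x y; rewrite ractDl (tsumD (balz z)).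
    + have balz' : balanced (fun x y : C => th x *> g (th y *> (beta a * h z))).
        split=> [m m' w|m w w'|m b w]; first by rewrite thetaD ractDl.
        * by rewrite thetaD ractDl ldualD ractDr.
        * by rewrite theta_ract thetaZ lractA ldualZ ractA.
      exact: (tsumD balz').
    + have balz' : balanced (fun x y : C => th x *> g (th y *> (beta a * h z))).
        split=> [m m' w|m w w'|m b w]; first by rewrite thetaD ractDl.
        * by rewrite thetaD ractDl ldualD ractDr.
        * by rewrite theta_ract thetaZ lractA ldualZ ractA.
      move=> x y; rewrite tens_ract (tsum_tens (balz z)) (tsum_tens balz').
      by rewrite theta_ract ractA.
rewrite -(tsum_tmap (h := @comul A C) (k := id) _ _ _ _ bal2) //;
  try exact: comulD; try exact: comul_ract.
apply: (tensor_ext (f := fun w => tsum _ (tassoc w)) (g := tsum _)).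
- by move=> x y; rewrite tassocD (tsumD balS).
- exact: (tsumD bal2).
move=> v z; rewrite (tsum_tens bal2).
apply: (tensor_ext (f := fun v => tsum _ (tassoc (tens v z))) (g := tsum _)).
- by move=> x y; rewrite tensDl tassocD (tsumD balS).
- exact: (tsumD (balz z)).
move=> x y; rewrite tassoc_tens (tsum_tens balS) (tsum_tens (balz z)).
by rewrite /S (tsum_tens (hcontr_bal h)).
Qed.

Fact hractA h (f g : ldual D) : hract (hract h f) g = hract h (f * g).
Proof.
apply: sharpP => c; rewrite !hractE hcontr_hract.
by symmetry; exact: lstarE.
Qed.
Fact hract1 h : hract h 1 = h.
Proof.
apply: sharpP => c; rewrite hractE.
transitivity (h (tsum (fun c1 c2 => counit c1 *: c2) (comul c))).
  rewrite sharp_tsum /hcontr ldual_tsum; apply: eq_tsum => c1 c2.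
  by rewrite sharpZ -(theta_counit th) -counit_ract.
by rewrite counitl.
Qed.
Fact hractDl h k g : hract (h + k) g = hract h g + hract k g.
Proof.
apply: sharpP => c; rewrite [RHS]/(hract h g c + hract k g c) !hractE.
transitivity (g (hcontr h c + hcontr k c)); last exact: ldualD.
congr (g _); rewrite /hcontr /tsum -big_split; apply: eq_bigr => p _.
exact: ractDr.
Qed.
Fact hractDr h (f g : ldual D) : hract h (f + g) = hract h f + hract h g.
Proof.
apply: sharpP => c.
by rewrite [RHS]/(hract h f c + hract h g c) !hractE.
Qed.
HB.instance Definition _ := Zmodule_isRmodule.Build (ldual D) (sharp th)
  hractA hract1 hractDl hractDr.

Fact sharp_lractA (f : ldual C) (h : sharp th) (g : ldual D) :
  (f *: h) *> g = f *: (h *> g).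
Proof.
apply: sharpP => c.
rewrite [LHS]hractE [RHS]hscaleE [RHS]hractE; congr (g _).
rewrite /hcontr.
have bal := hcontr_bal h.
have -> : comul (coact_star (c : coring_comod C) f) =
    contr f (tmap (@comul A C) id (comul c)).
  symmetry; rewrite /coact_star /=.
  apply: (tensor_ext (f := fun u => contr f (tmap (@comul A C) id u))
    (g := fun u => comul (contr f u))).
  - by move=> x y; rewrite tmapD ?contrD //; [exact: comulD|exact: comul_ract].
  - by move=> x y; rewrite contrD comulD.
  - move=> x y; rewrite tmap_tens //; try exact: comulD; try exact: comul_ract.
    by rewrite !contr_tens comul_ract.
pose S (v : tensor C C) : C := contr f v.
have balS : balanced (fun (m : C) (v : tensor C C) => th m *> h (S v)).
  split=> [m m' v|m v v'|m a v]; first by rewrite thetaD ractDl.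
  - by rewrite /S contrD sharpD ractDr.
  - by rewrite /S contr_lcomod sharpZ theta_ract ractA.
transitivity (tsum (fun m v => th m *> h (S v)) (tmap id (@comul A C) (comul c))).
  rewrite tsum_tmap //; try exact: comulD; try exact: comulZ.
  by apply: eq_tsum => c1 c2; rewrite [X in _ *> X](hscaleE f h).
rewrite -comulA.
apply: (tensor_ext (f := fun w => tsum _ (tassoc w))
  (g := fun w => tsum _ (contr f w))).
- by move=> x y; rewrite tassocD (tsumD balS).
- by move=> x y; rewrite contrD (tsumD bal).
move=> v z; rewrite contr_tens.
apply: (tensor_ext (f := fun v => tsum _ (tassoc (tens v z)))
  (g := fun v => tsum _ (v *> f z))).
- by move=> x y; rewrite tensDl tassocD (tsumD balS).
- by move=> x y; rewrite ractDl (tsumD bal).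
move=> x y; rewrite tassoc_tens (tsum_tens balS) tens_ract (tsum_tens bal).
by rewrite /S contr_tens.
Qed.
HB.instance Definition _ := isBimodule.Build (ldual C) (ldual D) (sharp th)
  sharp_lractA.
End SharpDual.

Coercion sharp_fun : sharp >-> Funclass.

Record subgroup (V : zmodType) := Subgroup {
  in_subgroup :> V -> Prop;
  subgroup0 : in_subgroup 0;
  subgroupD : forall x y, in_subgroup x -> in_subgroup y -> in_subgroup (x + y);
  subgroupN : forall x, in_subgroup x -> in_subgroup (- x)
}.

Record elt_of (V : zmodType) (P : subgroup V) := Elt {
  elt_val :> V;
  eltP : P elt_val
}.

Section EltOf.
Variables (V : zmodType) (P : subgroup V).
Local Notation S := (elt_of P).
HB.instance Definition _ := gen_eqMixin S.
HB.instance Definition _ := gen_choiceMixin S.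
Implicit Types x y : S.

Lemma elt_inj x y : elt_val x = elt_val y -> x = y.
Proof.
case: x y => [x xP] [y yP] /= xy; subst y.
by rewrite (Prop_irrelevance xP yP).
Qed.

Definition elt_zero : S := Elt (subgroup0 P).
Definition elt_add x y : S := Elt (subgroupD (eltP x) (eltP y)).
Definition elt_opp x : S := Elt (subgroupN (eltP x)).
Fact elt_addA : associative elt_add.
Proof. by move=> x y z; apply: elt_inj; exact: addrA. Qed.
Fact elt_addC : commutative elt_add.
Proof. by move=> x y; apply: elt_inj; exact: addrC. Qed.
Fact elt_add0 : left_id elt_zero elt_add.
Proof. by move=> x; apply: elt_inj; exact: add0r. Qed.
Fact elt_addN : left_inverse elt_zero elt_opp elt_add.
Proof. by move=> x; apply: elt_inj; exact: addNr. Qed.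
HB.instance Definition _ := GRing.isZmodule.Build S
  elt_addA elt_addC elt_add0 elt_addN.
End EltOf.

Section USharp.
Variables (A B : pzRingType) (beta : {rmorphism A -> B}).
Variables (C : coring A) (D : coring B) (th : coring_hom beta C D).

Definition in_usharpC (h : sharp th) : Prop :=
  exists phi : ldual C, forall c, h c = beta (phi c).
Definition in_usharpD (h : sharp th) : Prop :=
  exists g : ldual D, forall c, h c = g (th c).

Definition compatible : Prop := forall h, in_usharpD h -> in_usharpC h.

Fact usharpC0 : in_usharpC 0.
Proof. by exists 0 => c; rewrite [RHS]rmorph0. Qed.
Fact usharpCD h k : in_usharpC h -> in_usharpC k -> in_usharpC (h + k).
Proof.
move=> [f hf] [g kg]; exists (f + g) => c.
by rewrite [RHS]rmorphD -hf -kg.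
Qed.
Fact usharpCN h : in_usharpC h -> in_usharpC (- h).
Proof. by move=> [f hf]; exists (- f) => c; rewrite [RHS]rmorphN -hf. Qed.
Definition usharpC : subgroup (sharp th) :=
  Subgroup usharpC0 usharpCD usharpCN.

Fact usharpC_scale (f : ldual C) h : in_usharpC h -> in_usharpC (f *: h).
Proof.
move=> [g hg]; exists (f * g) => c; rewrite hscaleE hg; congr (beta _).
by symmetry; exact: lstarE.
Qed.

Fact usharpC_ract (g : ldual D) h :
  compatible -> in_usharpC h -> in_usharpC (h *> g).
Proof.
move=> hc [f hf].
have lin : linear_for (beta \; @GRing.mul B) (fun c : C => g (th c)).
  by move=> a c d /=; rewrite thetaD thetaZ ldualD ldualZ.
have [|f' f'P] := hc (mk_linear lin); first by exists g.
exists (f * f') => c; rewrite [LHS]hractE.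
transitivity (g (th (contr f (comul c)))).
  congr (g _); rewrite /hcontr /contr (@tsum_morph _ _ _ _ _ _ th).
  - by apply: eq_tsum => c1 c2; rewrite hf theta_ract.
  - by apply: (@addrI _ (th 0)); rewrite -thetaD !addr0.
  - exact: thetaD.
transitivity (beta (f' (contr f (comul c)))); first exact: f'P.
congr (beta _).
by symmetry; exact: lstarE.
Qed.
End USharp.

(* _#C. The index hc makes the right *D-action below available: _#C is stable
   under it only because of compatibility. *)
Definition usharp (A B : pzRingType) (beta : {rmorphism A -> B})
    (C : coring A) (D : coring B) (th : coring_hom beta C D)
    (hc : compatible th) : Type := elt_of (usharpC th).

Section USharpBimod.
Variables (A B : pzRingType) (beta : {rmorphism A -> B}).
Variables (C : coring A) (D : coring B) (th : coring_hom beta C D).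
Variable hc : compatible th.
Local Notation U := (usharp hc).
HB.instance Definition _ := GRing.Zmodule.copy U (elt_of (usharpC th)).

Definition usharp_scale (f : ldual C) (h : U) : U :=
  Elt (P := usharpC th) (usharpC_scale f (eltP h)).
Definition usharp_ract (h : U) (g : ldual D) : U :=
  Elt (P := usharpC th) (usharpC_ract g hc (eltP h)).

Fact usharp_scalerA a b v :
  usharp_scale a (usharp_scale b v) = usharp_scale (a * b) v.
Proof. by apply: elt_inj; exact: scalerA. Qed.
Fact usharp_scale1r : left_id 1 usharp_scale.
Proof. by move=> v; apply: elt_inj; exact: scale1r. Qed.
Fact usharp_scalerDr : right_distributive usharp_scale +%R.
Proof. by move=> a v w; apply: elt_inj; exact: scalerDr. Qed.
Fact usharp_scalerDl v : {morph usharp_scale^~ v : a b / a + b}.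
Proof. by move=> a b; apply: elt_inj; exact: scalerDl. Qed.
HB.instance Definition _ := GRing.Zmodule_isLmodule.Build (ldual C) U
  usharp_scalerA usharp_scale1r usharp_scalerDr usharp_scalerDl.

Fact usharp_ractA v a b :
  usharp_ract (usharp_ract v a) b = usharp_ract v (a * b).
Proof. by apply: elt_inj; exact: ractA. Qed.
Fact usharp_ract1 v : usharp_ract v 1 = v.
Proof. by apply: elt_inj; exact: ract1. Qed.
Fact usharp_ractDl v w a :
  usharp_ract (v + w) a = usharp_ract v a + usharp_ract w a.
Proof. by apply: elt_inj; exact: ractDl. Qed.
Fact usharp_ractDr v a b :
  usharp_ract v (a + b) = usharp_ract v a + usharp_ract v b.
Proof. by apply: elt_inj; exact: ractDr. Qed.
HB.instance Definition _ := Zmodule_isRmodule.Build (ldual D) U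
  usharp_ractA usharp_ract1 usharp_ractDl usharp_ractDr.

Fact usharp_lractA (f : ldual C) (h : U) (g : ldual D) :
  (f *: h) *> g = f *: (h *> g).
Proof. by apply: elt_inj; exact: (lractA f (elt_val h) g). Qed.
HB.instance Definition _ := isBimodule.Build (ldual C) (ldual D) U
  usharp_lractA.
End USharpBimod.

Section RHomZmod.
Variables (T : pzRingType) (P N : rmodType T).
Local Notation H := (rhom P N).
HB.instance Definition _ := gen_eqMixin H.
HB.instance Definition _ := gen_choiceMixin H.
Implicit Types f g : H.

Program Definition rhom_zero : H := @RHom T P N (fun _ => 0) _ _.
Next Obligation. by rewrite addr0. Qed.
Next Obligation. by rewrite ract0l. Qed.
Program Definition rhom_add f g : H := @RHom T P N (fun x => f x + g x) _ _.
Next Obligation. by rewrite !rhomD addrACA. Qed.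
Next Obligation. by rewrite !rhomA ractDl. Qed.
Program Definition rhom_opp f : H := @RHom T P N (fun x => - f x) _ _.
Next Obligation. by rewrite !rhomD opprD. Qed.
Next Obligation. by rewrite !rhomA ractNl. Qed.

Fact rhom_addA : associative rhom_add.
Proof. by move=> f g h; apply: rhomP => x; exact: addrA. Qed.
Fact rhom_addC : commutative rhom_add.
Proof. by move=> f g; apply: rhomP => x; exact: addrC. Qed.
Fact rhom_add0 : left_id rhom_zero rhom_add.
Proof. by move=> f; apply: rhomP => x; exact: add0r. Qed.
Fact rhom_addN : left_inverse rhom_zero rhom_opp rhom_add.
Proof. by move=> f; apply: rhomP => x; exact: addNr. Qed.
HB.instance Definition _ := GRing.isZmodule.Build H
  rhom_addA rhom_addC rhom_add0 rhom_addN.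
End RHomZmod.

Section RHomRmod.
Variables (S T : pzRingType) (P : bimodType S T) (N : rmodType T).
Local Notation H := (rhom P N).
Implicit Types f g : H.

Program Definition rhom_ract f (s : S) : H :=
  @RHom T P N (fun x => f (s *: x)) _ _.
Next Obligation. by rewrite scalerDr rhomD. Qed.
Next Obligation. by rewrite -lractA rhomA. Qed.

Fact rhom_ractA f s t : rhom_ract (rhom_ract f s) t = rhom_ract f (s * t).
Proof. by apply: rhomP => x /=; rewrite scalerA. Qed.
Fact rhom_ract1 f : rhom_ract f 1 = f.
Proof. by apply: rhomP => x /=; rewrite scale1r. Qed.
Fact rhom_ractDl f g s : rhom_ract (f + g) s = rhom_ract f s + rhom_ract g s.
Proof. exact: rhomP. Qed.
Fact rhom_ractDr f s t : rhom_ract f (s + t) = rhom_ract f s + rhom_ract f t.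
Proof. by apply: rhomP => x /=; rewrite scalerDl rhomD. Qed.
HB.instance Definition _ := Zmodule_isRmodule.Build S H
  rhom_ractA rhom_ract1 rhom_ractDl rhom_ractDr.
End RHomRmod.

Definition in_span (A : pzRingType) (W : lmodType A) (s : seq W) (w : W) : Prop :=
  exists k : 'I_(size s) -> A, w = \sum_(i < size s) k i *: s`_i.

(* The finitely generated submodules F are the spans of the finite lists s. *)
Definition locally_projective (A : pzRingType) (W : lmodType A) : Prop :=
  forall (L N : lmodType A) (p : {linear L -> N}) (g : {linear W -> N})
    (s : seq W),
  (forall y, exists x, p x = y) ->
  exists g' : {linear W -> L}, forall w, in_span s w -> g w = p (g' w).

Lemma mem_in_span (A : pzRingType) (W : lmodType A) (s : seq W) w :
  w \in s -> in_span s w.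
Proof.
move=> ws; have lt : (index w s < size s)%N by rewrite index_mem.
exists (fun i => (i == Ordinal lt)%:R).
rewrite (bigD1 (Ordinal lt)) //= eqxx scale1r nth_index // big1 ?addr0 //.
by move=> i /negPf ->; rewrite scale0r.
Qed.

Section FreeModule.
Variables (A : pzRingType) (W : lmodType A).

Definition finsupp (h : W -> reg A) : Prop :=
  exists s : seq W, forall w, w \notin s -> h w = 0.
Fact finsupp0 : finsupp 0. Proof. by exists [::]. Qed.
Fact finsuppD h k : finsupp h -> finsupp k -> finsupp (h + k).
Proof.
move=> [s hs] [t kt]; exists (s ++ t) => w; rewrite mem_cat negb_or => /andP[ws wt].
by rewrite /GRing.add /= hs // kt // addr0.
Qed.
Fact finsuppN h : finsupp h -> finsupp (- h).
Proof. by move=> [s hs]; exists s => w ws; rewrite /GRing.opp /= hs // oppr0. Qed.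
Fact finsuppZ (a : A) h : finsupp h -> finsupp (a *: h).
Proof.
by move=> [s hs]; exists s => w ws; rewrite /GRing.scale /= hs // scaler0.
Qed.

Definition finsupp_subgroup := Subgroup finsupp0 finsuppD finsuppN.
Definition freemod : Type := elt_of finsupp_subgroup.
HB.instance Definition _ := GRing.Zmodule.on freemod.

Definition fm_scale a (h : freemod) : freemod := Elt (P := finsupp_subgroup) (finsuppZ a (eltP h)).
Fact fm_scalerA a b v : fm_scale a (fm_scale b v) = fm_scale (a * b) v.
Proof. by apply: elt_inj; exact: scalerA. Qed.
Fact fm_scale1r : left_id 1 fm_scale.
Proof. by move=> v; apply: elt_inj; exact: scale1r. Qed.
Fact fm_scalerDr : right_distributive fm_scale +%R.
Proof. by move=> a v w; apply: elt_inj; exact: scalerDr. Qed.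
Fact fm_scalerDl v : {morph fm_scale^~ v : a b / a + b}.
Proof. by move=> a b; apply: elt_inj; exact: scalerDl. Qed.
HB.instance Definition _ := GRing.Zmodule_isLmodule.Build A freemod
  fm_scalerA fm_scale1r fm_scalerDr fm_scalerDl.

Definition fm_val (h : freemod) (w : W) : A := elt_val h w.

Lemma fm_supp (h : freemod) : exists2 s : seq W, uniq s &
  forall w, w \notin s -> fm_val h w = 0.
Proof.
have [s hs] := eltP h; exists (undup s); first exact: undup_uniq.
by move=> w; rewrite mem_undup; exact: hs.
Qed.

Definition fm_sum (h : freemod) : W :=
  \sum_(w <- projT1 (cid2 (fm_supp h))) fm_val h w *: w.

Lemma fm_sumE (h : freemod) s : uniq s ->
  (forall w, w \notin s -> fm_val h w = 0) ->
  fm_sum h = \sum_(w <- s) fm_val h w *: w.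
Proof.
rewrite /fm_sum; case: cid2 => /= t tu tP su sP.
have E r : \sum_(w <- r) fm_val h w *: w =
    \sum_(w <- [seq w <- r | fm_val h w != 0]) fm_val h w *: w.
  rewrite big_filter [RHS]big_mkcond; apply: eq_bigr => w _ /=.
  by case: eqP => //= ->; rewrite scale0r.
rewrite E [RHS]E; apply: perm_big; apply: uniq_perm; rewrite ?filter_uniq //.
move=> w; rewrite !mem_filter; have [//|hw /=] := eqVneq.
have [ws|/sP e] := boolP (w \in s); last by rewrite e eqxx in hw.
by have [//|/tP e] := boolP (w \in t); rewrite e eqxx in hw.
Qed.

Lemma fm_sum_lin : linear fm_sum.
Proof.
move=> a h k; have [s su sP] := fm_supp h; have [t tu tP] := fm_supp k.
pose r := undup (s ++ t).
have rh w : w \notin r -> fm_val h w = 0.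
  by rewrite mem_undup mem_cat negb_or => /andP[/sP].
have rk w : w \notin r -> fm_val k w = 0.
  by rewrite mem_undup mem_cat negb_or => /andP[_ /tP].
have ru : uniq r by exact: undup_uniq.
have vE w : fm_val (a *: h + k) w = a * fm_val h w + fm_val k w by [].
rewrite (fm_sumE ru rh) (fm_sumE ru rk) (fm_sumE ru); last first.
  by move=> w wr; rewrite vE rh // rk // mulr0 addr0.
rewrite scaler_sumr -big_split /=; apply: eq_bigr => w _.
by rewrite [X in X *: _](vE w) scalerDl scalerA.
Qed.

Fact finsupp_delta (w : W) : finsupp (fun v => (v == w)%:R : A).
Proof. by exists [:: w] => v; rewrite inE => /negPf ->. Qed.
Definition fm_delta (w : W) : freemod :=
  Elt (P := finsupp_subgroup) (finsupp_delta w).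

Lemma fm_sum_delta w : fm_sum (fm_delta w) = w.
Proof.
rewrite (@fm_sumE _ [:: w]) //; last first.
  by move=> v; rewrite inE /fm_val /= => /negPf ->.
by rewrite big_seq1 /fm_val /= eqxx scale1r.
Qed.
End FreeModule.

Section DualBasis.
Variables (A : pzRingType) (W : lmodType A).
Hypothesis hW : locally_projective W.

Lemma dual_basis (s : seq W) :
  exists fs : seq ({linear W -> A | *%R} * W),
    forall w, w \in s -> w = \sum_(q <- fs) q.1 w *: q.2.
Proof.
have [|g' g'P] := @hW _ _ (mk_linear (@fm_sum_lin A W))
    (mk_linear (s := *:%R) (f := idfun) (fun a (u v : W) => erefl (a *: u + v))) s.
  by move=> w; exists (fm_delta w); exact: fm_sum_delta.
have [T Tu TP] : exists2 T : seq W, uniq T &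
    forall w, w \in s -> forall v, v \notin T -> fm_val (g' w) v = 0.
  elim: s {g'P} => [|w s [T Tu IH]]; first by exists [::].
  have [t tu tP] := fm_supp (g' w).
  exists (undup (t ++ T)); first exact: undup_uniq.
  move=> w'; rewrite inE => /orP[/eqP ->|w's] v;
    rewrite mem_undup mem_cat negb_or => /andP[vt vT]; first exact: tP.
  exact: IH.
have lin v : linear_for (@GRing.mul A) (fun w => fm_val (g' w) v).
  by move=> a x y; rewrite linearP.
exists [seq (mk_linear (lin v), v) | v <- T] => w ws.
rewrite big_map /= -(fm_sumE Tu (TP w ws)).
exact: (g'P w (mem_in_span ws)).
Qed.

Lemma contr_inj (M : rmodType A) (u v : tensor M W) :
  (forall f : {linear W -> A | *%R}, contr f u = contr f v) -> u = v.
Proof.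
move=> uv; apply/eqP; rewrite -subr_eq0; apply/eqP.
set d := u - v.
have dP (f : {linear W -> A | *%R}) : contr f d = 0.
  by rewrite contrD contrN uv subrr.
have [fs fsP] := dual_basis [seq p.2 | p <- repr d].
rewrite [LHS]tensorE.
transitivity (\sum_(p <- repr d) \sum_(q <- fs) tens (p.1 *> q.1 p.2) q.2 : tensor M W).
  rewrite big_seq [RHS]big_seq; apply: eq_bigr => p pd.
  rewrite {1}(fsP p.2) ?map_f // tens_sumr; apply: eq_bigr => q _.
  by rewrite tens_bal.
rewrite exchange_big big1 //= => q _.
by rewrite -tens_suml [X in tens X _](dP q.1) tens0l.
Qed.
End DualBasis.

(* u = Sigma x_i (x) c_i satisfies x f = Sigma x_i f(c_i) for all f in *C *)
Definition rat_witness (A : pzRingType) (C : coring A) (X : rmodType (ldual C))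
    (x : X) (u : tensor (resR (ldual_of C) X) C) : Prop :=
  forall f : ldual C, x *> f = contr f u.

Section RatSubmodule.
Variables (A : pzRingType) (C : coring A) (X : rmodType (ldual C)).

Definition rational (x : X) : Prop := exists u, rat_witness x u.

Fact rational0 : rational 0.
Proof. by exists 0 => f; rewrite ract0l contr0. Qed.
Fact rationalD x y : rational x -> rational y -> rational (x + y).
Proof.
by move=> [u xu] [v yv]; exists (u + v) => f; rewrite ractDl contrD xu yv.
Qed.
Fact rationalN x : rational x -> rational (- x).
Proof. by move=> [u xu]; exists (- u) => f; rewrite ractNl contrN xu. Qed.
Definition rational_subgroup : subgroup X :=
  Subgroup rational0 rationalD rationalN.

Fact rational_ract x (f : ldual C) : rational x -> rational (x *> f).
Proof.
move=> [u xu].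
pose k (c : C) : C := coact_star (c : coring_comod C) f.
have kD : forall c d, k (c + d) = k c + k d.
  by move=> c d; exact: (@coact_starDl _ _ (coring_comod C)).
have kZ : forall (a : A) c, k (a *: c) = a *: k c.
  by move=> a c; rewrite /k /coact_star /= comulZ contr_lcomod.
exists (tmap id k u) => g.
rewrite ractA xu; symmetry.
apply: (@contr_tmap A (resR (ldual_of C) X) (resR (ldual_of C) X) C C id k g
  (f * g : ldual C)) => // c.
by symmetry; exact: lstarE.
Qed.

(* Rat^C(X), a right A-module along A -> *C. *)
Definition rat : Type := elt_of rational_subgroup.
HB.instance Definition _ := GRing.Zmodule.on rat.

Definition rat_ract (x : rat) (a : A) : rat :=
  Elt (P := rational_subgroup) (rational_ract (ldual_of C a) (eltP x)).
Fact rat_ractA x a b : rat_ract (rat_ract x a) b = rat_ract x (a * b).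
Proof. by apply: elt_inj; rewrite /= ractA rmorphM. Qed.
Fact rat_ract1 x : rat_ract x 1 = x.
Proof. by apply: elt_inj; rewrite /= rmorph1 ract1. Qed.
Fact rat_ractDl x y a : rat_ract (x + y) a = rat_ract x a + rat_ract y a.
Proof. by apply: elt_inj; exact: ractDl. Qed.
Fact rat_ractDr x a b : rat_ract x (a + b) = rat_ract x a + rat_ract x b.
Proof. by apply: elt_inj; rewrite /= rmorphD ractDr. Qed.
HB.instance Definition _ := Zmodule_isRmodule.Build A rat
  rat_ractA rat_ract1 rat_ractDl rat_ractDr.

Definition rat_val (x : rat) : X := elt_val x.

Definition rat_incl : tensor rat C -> tensor (resR (ldual_of C) X) C :=
  @tmap A rat (resR (ldual_of C) X) C C rat_val id.

Lemma contr_rat_incl (f : ldual C) (u : tensor rat C) :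
  contr f (rat_incl u) = rat_val (contr f u).
Proof. exact: contr_tmap. Qed.

End RatSubmodule.

Section RatComodule.
Variables (A : pzRingType) (C : coring A).
Hypothesis hC : locally_projective C.
Variable X : rmodType (ldual C).
Implicit Types x y : rat X.

Lemma contr_ldual_inj (M : rmodType A) (u v : tensor M C) :
  (forall f : ldual C, contr f u = contr f v) -> u = v.
Proof. by move=> uv; apply: (contr_inj hC) => f; exact: uv. Qed.

Lemma rat_coact_ex x :
  exists u : tensor (rat X) C, rat_witness (rat_val x) (rat_incl u).
Proof.
have [u0 xu] := eltP x.
have [fs fsP] := dual_basis hC [seq p.2 | p <- repr u0].
pose r (q : {linear C -> A | *%R} * C) : rat X :=
  Elt (P := rational_subgroup X) (rational_ract (q.1 : ldual C) (eltP x)).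
exists (\sum_(q <- fs) tens (r q) q.2) => g.
have cD (f : ldual C) : {morph @contr A (rat X) C f : u v / u + v}.
  exact: contrD.
rewrite contr_rat_incl (big_morph _ (cD g) (contr0 _ g)).
have vD : {morph @rat_val A C X : u v / u + v} by [].
rewrite (big_morph _ vD (erefl : rat_val 0 = 0)).
rewrite xu.
transitivity (\sum_(q <- fs) (elt_val x *> (q.1 : ldual C)) *> ldual_of C (g q.2)).
  rewrite [LHS]/contr [LHS]/tsum.
  under [RHS]eq_bigr do rewrite xu /contr /tsum ract_suml.
  rewrite exchange_big big_seq [RHS]big_seq /=; apply: eq_bigr => p pu.
  rewrite {1}(fsP p.2) ?map_f //.
  have gs (t : seq ({linear C -> A | *%R} * C)) :
      g (\sum_(q <- t) q.1 p.2 *: q.2) = \sum_(q <- t) q.1 p.2 * g q.2.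
    elim: t => [|q t IH]; first by rewrite !big_nil ldual0.
    by rewrite !big_cons ldualD ldualZ IH.
  rewrite gs.
  elim: fs {fsP gs} => [|q t IH]; first by rewrite !big_nil ract0r.
  by rewrite !big_cons ractDr IH ractA -rmorphM.
apply: eq_bigr => q _; by rewrite [in RHS]contr_tens.
Qed.

(* x |-> Sigma x_i (x) c_i *)
Definition rat_coact x : tensor (rat X) C := projT1 (cid (rat_coact_ex x)).

Lemma rat_coactP x : rat_witness (rat_val x) (rat_incl (rat_coact x)).
Proof. by rewrite /rat_coact; case: cid. Qed.

Lemma contr_rat_coact x (f : ldual C) :
  rat_val (contr f (rat_coact x)) = rat_val x *> f.
Proof. by rewrite rat_coactP contr_rat_incl. Qed.

Lemma rat_coact_uniq x (u : tensor (rat X) C) :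
  (forall f : ldual C, rat_val (contr f u) = rat_val x *> f) ->
  rat_coact x = u.
Proof.
by move=> xu; apply: contr_ldual_inj => f; apply: elt_inj;
  rewrite [LHS]contr_rat_coact -xu.
Qed.

Fact rat_coactD x y : rat_coact (x + y) = rat_coact x + rat_coact y.
Proof.
apply: rat_coact_uniq => f; rewrite contrD.
transitivity (rat_val (contr f (rat_coact x)) + rat_val (contr f (rat_coact y))) => //.
by rewrite !contr_rat_coact -ractDl.
Qed.

Lemma contr_ract (M : rmodType A) (f : ldual C) a (u : tensor M C) :
  contr f (u *> a) = contr (ldual_of C a * f : ldual C) u.
Proof.
apply: (tensor_ext (f := fun u => contr f (u *> a))
  (g := contr (ldual_of C a * f : ldual C))).
- by move=> x y; rewrite ractDl contrD.
- exact: contrD.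
- move=> m c; rewrite tens_ract !contr_tens; congr (_ *> _).
  rewrite [RHS](lstarE (ldual_of C a) f); congr (f _).
  rewrite -[in LHS](@coact_star1 _ _ (coring_comod C) c) /coact_star /contr.
  rewrite (@tsum_morph _ _ _ _ _ _ (ract^~ a)); first last.
  - by move=> x y; rewrite ractDl.
  - exact: ract0l.
  by apply: eq_tsum => c1 c2; rewrite ractA.
Qed.

Fact rat_coact_ract x a : rat_coact (x *> a) = rat_coact x *> a.
Proof.
apply: rat_coact_uniq => f; rewrite contr_ract contr_rat_coact.
by rewrite -ractA.
Qed.

Lemma tassoc_surj (A' : pzRingType) (M : rmodType A') (N : bimodType A' A')
  (P : lmodType A') (v : tensor M (tensor N P)) :
  exists u : tensor (tensor M N) P, tassoc u = v.
Proof.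
elim/tensor_ind: v => [|m w|v w [u <-] [t <-]].
- exists 0; apply: (@addrI _ (tassoc 0)).
  by rewrite -tassocD !addr0.
- elim/tensor_ind: w => [|n p|w w' [u uE] [t tE]].
  + exists 0; rewrite tens0r; apply: (@addrI _ (tassoc 0)).
    by rewrite -tassocD !addr0.
  + by exists (tens (tens m n) p); rewrite tassoc_tens.
  + by exists (u + t); rewrite tassocD uE tE tensDr.
- by exists (u + t); rewrite tassocD.
Qed.

Lemma contr_comul_tsum (M : rmodType A) (f g : ldual C) (u : tensor M C) :
  tsum (fun m v => m *> g (contr f v)) (tmap id (@comul A C) u) =
  contr (f * g : ldual C) u.
Proof.
rewrite tsum_tmap //; try exact: comulD; try exact: comulZ.
  by apply: eq_tsum => m c; congr (_ *> _); symmetry; exact: lstarE.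
split=> [m m' v|m v v'|m a v]; first exact: ractDl.
- by rewrite contrD ldualD ractDr.
- by rewrite contr_lcomod ldualZ ractA.
Qed.

Fact rat_coactA x :
  tassoc (tmap rat_coact id (rat_coact x)) =
    tmap id (@comul A C) (rat_coact x).
Proof.
have [u2 u2E] := tassoc_surj (tmap id (@comul A C) (rat_coact x)).
rewrite -u2E; congr tassoc.
apply: contr_ldual_inj => f; apply: contr_ldual_inj => g.
rewrite [RHS]contr_assoc u2E contr_comul_tsum.
rewrite (@contr_tmap _ _ _ _ _ rat_coact id f f) //;
  [|exact: rat_coactD|exact: rat_coact_ract].
by apply: elt_inj; rewrite -!/(rat_val _) !contr_rat_coact ractA.
Qed.

Fact rat_coact_counit x :
  tsum (fun m0 m1 => m0 *> counit m1) (rat_coact x) = x.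
Proof.
apply: elt_inj; rewrite -!/(rat_val _).
by rewrite [LHS](contr_rat_coact x (lone C)) [LHS]ract1.
Qed.

Definition rat_comod : comodule C :=
  @Comodule A C (rat X) rat_coact rat_coactD rat_coact_ract rat_coactA
    rat_coact_counit.

End RatComodule.

Section RatMap.
Variables (A : pzRingType) (C : coring A).
Hypothesis hC : locally_projective C.
Variables (X Y : rmodType (ldual C)) (f : rhom X Y).

Fact rational_map x : rational x -> rational (f x).
Proof.
move=> [u xu].
exists (@tmap A (resR (ldual_of C) X) (resR (ldual_of C) Y) C C f id u) => g.
rewrite -rhomA xu; symmetry.
apply: (@contr_tmap A (resR (ldual_of C) X) (resR (ldual_of C) Y) C C f id g g)
  => //; first exact: (rhomD f).
by move=> v a; exact: (rhomA f v (ldual_of C a)).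
Qed.

Definition rat_map_fun (x : rat_comod hC X) : rat_comod hC Y :=
  Elt (P := rational_subgroup Y) (rational_map (eltP x)).

Fact rat_map_funD x y : rat_map_fun (x + y) = rat_map_fun x + rat_map_fun y.
Proof. by apply: elt_inj; exact: rhomD. Qed.
Fact rat_map_funA x a : rat_map_fun (x *> a) = rat_map_fun x *> a.
Proof. by apply: elt_inj; exact: rhomA. Qed.
Fact rat_map_funP x :
  coact (rat_map_fun x) = tmap rat_map_fun id (coact x).
Proof.
apply: (rat_coact_uniq hC (X := Y)) => g.
rewrite (@contr_tmap _ _ _ _ _ rat_map_fun id g g) //;
  [|exact: rat_map_funD|exact: rat_map_funA].
rewrite -[RHS](rhomA f (rat_val x) g) -(contr_rat_coact hC).
by [].
Qed.
Definition rat_map : comod_hom (rat_comod hC X) (rat_comod hC Y) :=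
  @ComodHom A C (rat_comod hC X) (rat_comod hC Y)
    (RHom rat_map_funD rat_map_funA) rat_map_funP.
End RatMap.

Record category := Category {
  cat_obj :> Type;
  cat_hom : cat_obj -> cat_obj -> Type;
  cat_id : forall X, cat_hom X X;
  cat_comp : forall X Y Z, cat_hom Y Z -> cat_hom X Y -> cat_hom X Z;
  cat_compA : forall X Y Z T (h : cat_hom Z T) (g : cat_hom Y Z)
    (f : cat_hom X Y), cat_comp h (cat_comp g f) = cat_comp (cat_comp h g) f;
  cat_comp1l : forall X Y (f : cat_hom X Y), cat_comp (cat_id Y) f = f;
  cat_comp1r : forall X Y (f : cat_hom X Y), cat_comp f (cat_id X) = f
}.

Record functor (C D : category) := Functor {
  fobj :> C -> D;
  fmap : forall X Y : C, cat_hom X Y -> cat_hom (fobj X) (fobj Y);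
  fmap1 : forall X : C, fmap (cat_id X) = cat_id (fobj X);
  fmapM : forall (X Y Z : C) (g : cat_hom Y Z) (f : cat_hom X Y),
    fmap (cat_comp g f) = cat_comp (fmap g) (fmap f)
}.

Definition left_adjoint (C D : category) (F : functor C D) (G : functor D C)
  : Prop :=
  exists Phi : forall (X : C) (Y : D), cat_hom (F X) Y -> cat_hom X (G Y),
  [/\ forall X Y, bijective (@Phi X Y),
      forall (X X' : C) (Y : D) (f : cat_hom X' X) (h : cat_hom (F X) Y),
        Phi X' Y (cat_comp h (fmap F f)) = cat_comp (Phi X Y h) f
    & forall (X : C) (Y Y' : D) (g : cat_hom Y Y') (h : cat_hom (F X) Y),
        Phi X Y' (cat_comp g h) = cat_comp (fmap G g) (Phi X Y h)].

Section ComodCategory.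
Variables (A : pzRingType) (C : coring A).

Lemma tmap_id (M : rmodType A) (N : lmodType A) (u : tensor M N) :
  tmap id id u = u.
Proof.
apply: (tensor_ext (f := tmap id id) (g := id)) => //.
- exact: tmapD.
- by move=> m n; rewrite tmap_tens.
Qed.

Lemma tmap_comp (M M' M'' : rmodType A) (N : lmodType A)
    (g : rhom M' M'') (f : rhom M M') (u : tensor M N) :
  tmap g id (tmap f id u) = tmap (g \o f) id u.
Proof.
apply: (tsum_tmap (F := fun m n => tens (g m) n)) => //;
  [exact: rhomD|exact: rhomA|].
by apply: tmap_bal => //; [exact: rhomD|exact: rhomA].
Qed.

Definition rhom_id (M : rmodType A) : rhom M M :=
  @RHom A M M id (fun _ _ => erefl) (fun _ _ => erefl).

Program Definition rhom_comp (M N P : rmodType A) (g : rhom N P) (f : rhom M N)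
  : rhom M P := @RHom A M P (fun x => g (f x)) _ _.
Next Obligation. by rewrite !rhomD. Qed.
Next Obligation. by rewrite !rhomA. Qed.

Definition comod_id (M : comodule C) : comod_hom M M :=
  @ComodHom A C M M (rhom_id M) (fun m => esym (tmap_id (coact m))).

Program Definition comod_comp (M N P : comodule C) (g : comod_hom N P)
    (f : comod_hom M N) : comod_hom M P :=
  @ComodHom A C M P (rhom_comp g f) _.
Next Obligation. by rewrite !comod_homP tmap_comp. Qed.

Program Definition comod_cat : category :=
  @Category (comodule C) (@comod_hom A C) comod_id comod_comp _ _ _.
Next Obligation. exact: comod_hom_eq. Qed.
Next Obligation. exact: comod_hom_eq. Qed.
Next Obligation. exact: comod_hom_eq. Qed.
End ComodCategory.

Section Coinduction.
Variables (A B : pzRingType) (beta : {rmorphism A -> B}).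
Variables (C : coring A) (D : coring B) (th : coring_hom beta C D).
Hypothesis hC : locally_projective C.
Hypothesis hc : compatible th.

Definition coind_hom (N : comodule D) : rmodType (ldual C) :=
  rhom (usharp hc) (comod_star N).

Definition coind_obj (N : comodule D) : comodule C := rat_comod hC (coind_hom N).

Lemma comod_hom_star (N N' : comodule D) (k : comod_hom N N') (n : N)
  (g : ldual D) : k (coact_star n g) = coact_star (k n) g.
Proof.
rewrite /coact_star comod_homP; symmetry.
by apply: (@contr_tmap _ _ _ _ _ k id g g) => //; [exact: rhomD|exact: rhomA].
Qed.

Section Map.
Variables (N N' : comodule D) (k : comod_hom N N').

Program Definition coind_post (phi : coind_hom N) : coind_hom N' :=
  @RHom _ (usharp hc) (comod_star N') (fun h => k (phi h)) _ _.
Next Obligation. by rewrite !rhomD. Qed.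
Next Obligation. by rewrite !rhomA; exact: comod_hom_star. Qed.

Fact coind_postD phi psi :
  coind_post (phi + psi) = coind_post phi + coind_post psi.
Proof. by apply: rhomP => h; exact: (rhomD k (phi h) (psi h)). Qed.
Fact coind_postA phi f : coind_post (phi *> f) = coind_post phi *> f.
Proof. exact: rhomP. Qed.

Definition coind_map : comod_hom (coind_obj N) (coind_obj N') :=
  rat_map hC (RHom coind_postD coind_postA).
End Map.

Program Definition Coind : functor (comod_cat D) (comod_cat C) :=
  @Functor (comod_cat D) (comod_cat C) coind_obj coind_map _ _.
Next Obligation.
by apply: comod_hom_eq => x; apply: elt_inj; exact: rhomP.
Qed.
Next Obligation.
by apply: comod_hom_eq => x; apply: elt_inj; exact: rhomP.
Qed.
End Coinduction.

Section Induction.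
Variables (A B : pzRingType) (beta : {rmorphism A -> B}).
Variables (C : coring A) (D : coring B) (th : coring_hom beta C D).

Definition ind_mod (M : rmodType A) : rmodType B := tensor M (resL beta (reg B)).

Section Obj.
Variable M : comodule C.
Local Notation MB := (ind_mod M).
Local Notation "m (x) b" := (@tens A M (resL beta (reg B)) m b : MB)
  (at level 40).
Local Notation "w (xx) d" := (@tens B MB D w d) (at level 40).

Definition ind_term (b : B) (m : M) (c : C) : tensor MB D :=
  (m (x) 1) (xx) (th c *> b).

(* m (x) b |-> Sigma (m_0 (x) 1) (x)_B theta(m_1) b, which corresponds to
   Sigma m_0 (x)_A theta(m_1) b under (M (x)_A B) (x)_B D = M (x)_A D *)
Definition ind_coact (w : MB) : tensor MB D :=
  @tsum A M (resL beta (reg B)) _ (fun m b => tsum (ind_term b) (coact m)) w.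

Lemma ind_bal_l (m : M) (a : A) : (m *> a) (x) 1 = (m (x) 1) *> beta a.
Proof.
rewrite tens_bal [RHS]tens_ract; congr tens.
exact: (etrans (mulr1 (beta a)) (esym (mul1r (beta a)))).
Qed.

Lemma ind_term_bal b : balanced (ind_term b).
Proof.
rewrite /ind_term; split=> [m m' c|m c c'|m a c].
- by rewrite -[RHS]tensDl -tensDl.
- by rewrite thetaD ractDl tensDr.
- by rewrite ind_bal_l tens_bal thetaZ lractA.
Qed.

Lemma ind_term_ract b (a : A) (u : tensor M C) :
  tsum (ind_term b) (u *> a) = tsum (ind_term (beta a * b)) u.
Proof.
apply: (tensor_ext (f := fun u => tsum (ind_term b) (u *> a)) (g := tsum _)).
- by move=> x y; rewrite ractDl (tsumD (ind_term_bal b)).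
- exact: (tsumD (ind_term_bal _)).
- move=> m c; rewrite tens_ract !(tsum_tens (ind_term_bal _)) /ind_term.
  by rewrite theta_ract ractA.
Qed.

Lemma ind_term_mul b b' (u : tensor M C) :
  tsum (ind_term (b * b')) u = tsum (ind_term b) u *> b'.
Proof.
rewrite (@tsum_morph _ _ _ _ _ _ (ract^~ b')); last 1 first.
- by move=> x y; rewrite ractDl.
- by apply: eq_tsum => m c; rewrite /ind_term tens_ract ractA.
- exact: ract0l.
Qed.

Fact ind_coact_bal : @balanced A M (resL beta (reg B)) _
  (fun m b => tsum (ind_term b) (coact m)).
Proof.
split=> [m m' b|m b b'|m a b].
- by rewrite coactD (tsumD (ind_term_bal b)).
- rewrite /tsum -big_split; apply: eq_bigr => p _.
  by rewrite /ind_term ractDr tensDr.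
- by rewrite coact_ract ind_term_ract.
Qed.

Lemma ind_coact_tens (m : M) (b : B) :
  ind_coact (m (x) b) = tsum (ind_term b) (coact m).
Proof. exact: (tsum_tens ind_coact_bal). Qed.

Fact ind_coactD v w : ind_coact (v + w) = ind_coact v + ind_coact w.
Proof. exact: (tsumD ind_coact_bal). Qed.

Fact ind_coact_ract w b : ind_coact (w *> b) = ind_coact w *> b.
Proof.
apply: (tensor_ext (f := fun w : MB => ind_coact (w *> b))
  (g := fun w : MB => ind_coact w *> b)).
- by move=> x y; rewrite ractDl ind_coactD.
- by move=> x y; rewrite ind_coactD ractDl.
- move=> m b'; rewrite tens_ract.
  by rewrite [LHS]ind_coact_tens [in RHS]ind_coact_tens -ind_term_mul.
Qed.

Fact ind_coact_counit w :
  tsum (fun w0 d => w0 *> counit d) (ind_coact w) = w.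
Proof.
have bal : balanced (fun (w0 : MB) (d : D) => w0 *> counit d).
  split=> [x y d|x d d'|x b d]; first exact: ractDl.
  - by rewrite counitD ractDr.
  - by rewrite counitZ ractA.
apply: (tensor_ext (f := fun w => tsum (fun w0 d => w0 *> counit d) (ind_coact w))
  (g := id)) => //.
- by move=> x y; rewrite ind_coactD (tsumD bal).
move=> m b; rewrite ind_coact_tens.
rewrite (@tsum_morph _ _ _ _ _ _ (tsum _)); last 1 first.
- exact: (tsumD bal).
- transitivity (tsum (fun m0 m1 => m0 *> counit m1) (coact m) (x) b);
    last by rewrite coact_counit.
  rewrite [RHS](@tsum_morph _ _ _ _ _ _ (fun m => m (x) b)).
  + apply: eq_tsum => m0 m1; rewrite /ind_term (tsum_tens bal) counit_ract.
    rewrite theta_counit [LHS]tens_ract [RHS]tens_bal; congr tens.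
    exact: mul1r.
  + exact: tens0l.
  + by move=> x y; exact: tensDl.
- exact: (tsum0 bal).
Qed.

Fact ind_coactA w :
  tassoc (tmap ind_coact id (ind_coact w)) =
    tmap id (@comul B D) (ind_coact w).
Proof.
have tm1D := tmapD (N := D) (g := id) ind_coactD ind_coact_ract
  (fun _ _ => erefl) (fun _ _ => erefl).
have tm2D := tmapD (M := MB) (f := id) (fun _ _ => erefl) (fun _ _ => erefl)
  (@comulD B D) (@comulZ B D).
apply: (tensor_ext
  (f := fun w => tassoc (tmap ind_coact id (ind_coact w)))
  (g := fun w => tmap id (@comul B D) (ind_coact w))).
- by move=> x y; rewrite ind_coactD tm1D tassocD.
- by move=> x y; rewrite ind_coactD tm2D.
move=> m b; rewrite ind_coact_tens.
pose K (v : tensor C C) : tensor D D :=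
  tsum (fun c1 c2 => tens (th c1) (th c2 *> b)) v.
have balK : balanced (fun c1 c2 : C => tens (th c1) (th c2 *> b)).
  split=> [c c' d|c d d'|c a d]; first by rewrite thetaD tensDl.
  - by rewrite thetaD ractDl tensDr.
  - by rewrite theta_ract tens_bal thetaZ lractA.
have KD u v : K (u + v) = K u + K v by exact: (tsumD balK).
have KZ (a : A) v : K (a *: v) = beta a *: K v.
  apply: (tensor_ext (f := fun v => K (a *: v)) (g := fun v => beta a *: K v)).
  - by move=> x y; rewrite scalerDr KD.
  - by move=> x y; rewrite KD scalerDr.
  - move=> c d; rewrite tens_scale /K !(tsum_tens balK) thetaZ.
    by rewrite tens_scale.
pose J (m : M) (v : tensor C C) : tensor MB (tensor D D) :=
  tens (m (x) 1) (K v).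
have balJ : balanced J.
  rewrite /J; split=> [x y v|x v v'|x a v].
  - by rewrite -[RHS]tensDl -tensDl.
  - by rewrite KD tensDr.
  - by rewrite ind_bal_l tens_bal KZ.
transitivity (tsum J (tmap id (@comul A C) (coact m))); last first.
  rewrite tsum_tmap //; try exact: comulD; try exact: comulZ.
  rewrite (@tsum_morph _ _ _ _ _ _ (tmap id (@comul B D))) //; last first.
    by apply: tmap0 => //; [exact: comulD|exact: comulZ].
  apply: eq_tsum => m0 m1; rewrite /J /ind_term tmap_tens //;
    [|exact: comulD|exact: comulZ].
  congr tens; rewrite comul_ract /K.
  have balb : balanced (fun d d' : D => tens d (d' *> b)).
    split=> [x y d|x d d'|x a d]; first exact: tensDl.
    - by rewrite ractDl tensDr.
    - by rewrite tens_bal lractA.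
  rewrite -(theta_comul_tsum th balb) [LHS]/tsum.
  by [].
rewrite -coactA.
rewrite (@tsum_morph _ _ _ _ _ _ (tmap ind_coact id)) //; last first.
  by apply: tmap0 => //; [exact: ind_coactD|exact: ind_coact_ract].
rewrite (@tsum_morph _ _ _ _ _ _ (@tassoc B B MB D D)); first last.
- exact: tassocD.
- apply: (@addrI _ (tassoc 0)).
  by rewrite -tassocD !addr0.
have E m0 m1 : tassoc (tmap ind_coact id (ind_term b m0 m1)) =
    tsum J (tassoc (tens (coact m0) m1)).
  rewrite /ind_term tmap_tens //;
    [|exact: ind_coactD|exact: ind_coact_ract].
  rewrite ind_coact_tens.
  apply: (tensor_ext
    (f := fun u => tassoc (tens (tsum (ind_term 1) u) (th m1 *> b)))
    (g := fun u => tsum J (tassoc (tens u m1)))).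
  - by move=> x y; rewrite (tsumD (ind_term_bal 1)) tensDl tassocD.
  - by move=> x y; rewrite tensDl tassocD (tsumD balJ).
  move=> x c; rewrite (tsum_tens (ind_term_bal 1)) /ind_term !tassoc_tens.
  by rewrite (tsum_tens balJ) /J /K (tsum_tens balK) ract1.
transitivity (tsum (fun m0 m1 => tsum J (tassoc (tens (coact m0) m1))) (coact m)).
  by apply: eq_tsum => m0 m1; exact: E.
have balL : balanced (fun (u : tensor M C) (c : C) => tsum J (tassoc (tens u c))).
  split=> [u v c|u c d|u a c].
  - by rewrite tensDl tassocD (tsumD balJ).
  - by rewrite tensDr tassocD (tsumD balJ).
  - by rewrite tens_bal.
rewrite -(tsum_tmap (h := @coact A C M) (k := id) _ _ _ _ balL) //;
  [|exact: coactD|exact: coact_ract].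
apply: (tensor_ext (f := tsum _) (g := fun v => tsum J (tassoc v))).
- exact: (tsumD balL).
- by move=> x y; rewrite tassocD (tsumD balJ).
- by move=> u c; rewrite (tsum_tens balL).
Qed.

Definition ind_obj : comodule D :=
  @Comodule B D MB ind_coact ind_coactD ind_coact_ract ind_coactA
    ind_coact_counit.
End Obj.

Section Map.
Variables (M M' : comodule C) (k : comod_hom M M').

Definition ind_map_fun : ind_mod M -> ind_mod M' :=
  @tmap A M M' (resL beta (reg B)) (resL beta (reg B)) k id.

Lemma ind_map_fun_tens m b :
  ind_map_fun (tens m b) = tens (k m) b.
Proof. by apply: tmap_tens => //; [exact: rhomD|exact: rhomA]. Qed.
Fact ind_map_funD v w : ind_map_fun (v + w) = ind_map_fun v + ind_map_fun w.
Proof. by apply: tmapD => //; [exact: rhomD|exact: rhomA]. Qed.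
Fact ind_map_funA v b : ind_map_fun (v *> b) = ind_map_fun v *> b.
Proof.
apply: (tensor_ext (f := fun v : ind_mod M => ind_map_fun (v *> b))
  (g := fun v : ind_mod M => ind_map_fun v *> b)).
- by move=> x y; rewrite ractDl ind_map_funD.
- by move=> x y; rewrite ind_map_funD ractDl.
- move=> m b'; rewrite tens_ract.
  by rewrite [LHS]ind_map_fun_tens [in RHS]ind_map_fun_tens [RHS]tens_ract.
Qed.
Fact ind_map_funP (w : ind_obj M) :
  @coact B D (ind_obj M') (ind_map_fun w) =
    tmap ind_map_fun id (@coact B D (ind_obj M) w).
Proof.
have tmD := tmapD (N := D) (g := id) ind_map_funD ind_map_funA
  (fun _ _ => erefl) (fun _ _ => erefl).
apply: (tensor_ext (f := fun w => ind_coact (ind_map_fun w))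
  (g := fun w => tmap ind_map_fun id (ind_coact w))).
- by move=> x y; rewrite ind_map_funD ind_coactD.
- by move=> x y; rewrite ind_coactD tmD.
move=> m b; rewrite ind_map_fun_tens !ind_coact_tens comod_homP.
rewrite tsum_tmap //; try exact: rhomD; try exact: rhomA;
  last exact: ind_term_bal.
rewrite (@tsum_morph _ _ _ _ _ _ (tmap ind_map_fun id)) //; last first.
  by apply: tmap0 => //; [exact: ind_map_funD|exact: ind_map_funA].
apply: eq_tsum => m0 m1; rewrite /ind_term tmap_tens //;
  [|exact: ind_map_funD|exact: ind_map_funA].
by rewrite ind_map_fun_tens.
Qed.
Definition ind_map : comod_hom (ind_obj M) (ind_obj M') :=
  @ComodHom B D (ind_obj M) (ind_obj M') (RHom ind_map_funD ind_map_funA)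
    ind_map_funP.
End Map.

Program Definition Ind : functor (comod_cat C) (comod_cat D) :=
  @Functor (comod_cat C) (comod_cat D) ind_obj ind_map _ _.
Next Obligation.
by apply: comod_hom_eq => w; exact: tmap_id.
Qed.
Next Obligation.
apply: comod_hom_eq => w; symmetry.
exact: (tmap_comp g f w).
Qed.
End Induction.

(* Main.v *)
(* The adjunction is built from its unit and counit. Evaluating the coaction
   against k in _#C gives the unit m |-> (k |-> Sigma m_0 (x) k(m_1)), and the
   counit evaluates at u = beta o eps_C: x (x) b |-> x(u) b. Every element
   beta o f of _#C is f -> u, so u generates _#C over *C and an element x of the
   coinduced module is determined by the values (x f)(u). Since eps_D o theta = u
   as well, g o theta = u <- g; compatibility writes it as f -> u, whence
   x(u) g = (x f)(u). Local projectivity then turns the *C- and *D-linear maps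
   so obtained into colinear ones. *)

Require Import Defs.
From mathcomp Require Import all_boot all_algebra.

Set Implicit Arguments.
Unset Strict Implicit.
Unset Printing Implicit Defensive.

Import GRing.Theory.
Local Open Scope ring_scope.

(** * Adjunctions from unit and counit *)

Lemma left_adjoint_unit_counit (C D : category) (F : functor C D)
    (G : functor D C) (eta : forall X : C, cat_hom X (G (F X)))
    (eps : forall Y : D, cat_hom (F (G Y)) Y) :
    (forall (X X' : C) (f : cat_hom X' X),
      cat_comp (eta X) f = cat_comp (fmap G (fmap F f)) (eta X')) ->
    (forall (Y Y' : D) (g : cat_hom Y Y'),
      cat_comp g (eps Y) = cat_comp (eps Y') (fmap F (fmap G g))) ->
    (forall X : C, cat_comp (eps (F X)) (fmap F (eta X)) = cat_id (F X)) ->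
    (forall Y : D, cat_comp (fmap G (eps Y)) (eta (G Y)) = cat_id (G Y)) ->
  left_adjoint F G.
Proof.
move=> eta_nat eps_nat triF triG.
exists (fun X Y h => cat_comp (fmap G h) (eta X)); split.
(* The naturality of [eps] with [triF] cancels one composite, the naturality of [eta] with [triG]
   the other. *)
- move=> X Y; exists (fun k => cat_comp (eps Y) (fmap F k)) => [h|k].
    by rewrite fmapM cat_compA -eps_nat -cat_compA triF cat_comp1r.
  by rewrite fmapM -cat_compA -eta_nat cat_compA triG cat_comp1l.
- by move=> X X' Y f h; rewrite fmapM -!cat_compA eta_nat.
- by move=> X Y Y' g h; rewrite fmapM cat_compA.
Qed.

(** * Comodules as modules over the left dual *)

Section ComoduleStar.
Variables (A : pzRingType) (C : coring A).

(** Coassociativity for maps of three variables: [T] factors through both bracketings of the triple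
    tensor product, and [tassoc] matches the two factorizations. *)
Lemma coact_tsumA (M : comodule C) (G : zmodType) (T : M -> C -> C -> G) :
    (forall d, balanced (fun m c => T m c d)) ->
    (forall m, balanced (T m)) ->
  forall m,
  tsum (fun m0 d => tsum (fun n c => T n c d) (coact m0)) (coact m) =
  tsum (fun n d => tsum (T n) (comul d)) (coact m).
Proof.
move=> balM balC m.
have balS : balanced (fun n (v : tensor C C) => tsum (T n) v).
  split=> [n n' v|n v v'|n a v].
  - rewrite /tsum -big_split; apply: eq_bigr => p _.
    exact: (balDl (balM _)).
  - exact: (tsumD (balC _)).
  - apply: (tensor_ext (f := tsum (T (n *> a)))
      (g := fun v => tsum (T n) (a *: v))).
    + exact: (tsumD (balC _)).
    + by move=> x y; rewrite scalerDr (tsumD (balC _)).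
    + move=> c d; rewrite tens_scale !(tsum_tens (balC _)).
      exact: (balA (balM _)).
have balR : balanced (fun (u : tensor M C) d => tsum (fun n c => T n c d) u).
  split=> [u u' d|u d d'|u a d].
  - exact: (tsumD (balM _)).
  - rewrite /tsum -big_split; apply: eq_bigr => p _.
    exact: (balDr (balC _)).
  - apply: (tensor_ext (f := fun u => tsum (fun n c => T n c d) (u *> a))
      (g := tsum (fun n c => T n c (a *: d)))).
    + by move=> x y; rewrite ractDl (tsumD (balM _)).
    + exact: (tsumD (balM _)).
    + move=> n c; rewrite tens_ract !(tsum_tens (balM _)).
      exact: (balA (balC _)).
transitivity (tsum (fun n v => tsum (T n) v) (tmap id (@comul A C) (coact m)));
  last by rewrite tsum_tmap //; [exact: comulD|exact: comulZ].
transitivity (tsum (fun u d => tsum (fun n c => T n c d) u)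
  (tmap (@coact A C M) id (coact m)));
  first by rewrite tsum_tmap //; [exact: coactD|exact: coact_ract].
(* Both sides are now additive in one element of (M (x) C) (x) C, so pure tensors suffice. *)
rewrite -coactA; move: (tmap _ _ _).
apply: tensor_ext; first exact: (tsumD balR).
  by move=> x y; rewrite tassocD (tsumD balS).
move=> u d; rewrite (tsum_tens balR).
apply: (tensor_ext (f := tsum (fun n c => T n c d))
  (g := fun u => tsum (fun n v => tsum (T n) v) (tassoc (tens u d)))).
- exact: (tsumD (balM _)).
- by move=> x y; rewrite tensDl tassocD (tsumD balS).
- by move=> n c; rewrite tassoc_tens (tsum_tens balS) (tsum_tens (balM _))
    (tsum_tens (balC _)).
Qed.

(** By the counit law, restricting the *C-action along [ldual_of] returns the original A-action;
    hence *C-linear maps are A-linear. *)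
Lemma coact_star_of (M : comodule C) (m : M) (a : A) :
  coact_star m (ldual_of C a) = m *> a.
Proof.
rewrite -[in RHS](coact_counit m) (@tsum_morph _ _ _ _ _ _ (ract^~ a)).
- by apply: eq_tsum => n c; rewrite ractA.
- exact: ract0l.
- by move=> x y; exact: ractDl.
Qed.

Lemma coact_star_ract (M : comodule C) (m : M) (a : A) (f : ldual C) :
  coact_star (m *> a) f = coact_star m (ldual_of C a * f).
Proof. by rewrite -coact_star_of coact_starA. Qed.

Hypothesis hC : locally_projective C.

Section StarColinear.
Variables (M N : comodule C) (k : rhom (comod_star M) (comod_star N)).

Fact star_rhomA (m : M) (a : A) : k (m *> a) = (k m : N) *> a.
Proof. by rewrite -!coact_star_of; exact: (rhomA k m (ldual_of C a)). Qed.

Definition star_rhom : rhom M N :=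
  @RHom A M N (fun m => k m) (rhomD k) star_rhomA.

(** Since C is locally projective, the forms f in *C separate the elements of N (x) C; contracting
    both sides with f leaves k(m) f = k(m f). *)
Fact star_rhomP m : coact (star_rhom m) = tmap star_rhom id (coact m).
Proof.
apply: (contr_ldual_inj hC) => f.
rewrite (@contr_tmap _ _ _ _ _ star_rhom id f f) //;
  [|exact: rhomD|exact: rhomA].
by symmetry; exact: (rhomA k m f).
Qed.

Definition star_comod_hom : comod_hom M N := ComodHom star_rhomP.
End StarColinear.

Section RatCorestriction.
Variables (M : comodule C) (X : rmodType (ldual C)).
Variable k : rhom (comod_star M) X.

Let kA (m : M) (a : A) : k (m *> a) = (k m : resR (ldual_of C) X) *> a.
Proof. by rewrite -coact_star_of; exact: (rhomA k m (ldual_of C a)). Qed.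

(** The witness is Sigma k(m_0) (x) m_1, because k(m) f = k(m f). *)
Fact rat_corestr_rational (m : M) : rational (k m).
Proof.
exists (@tmap A M (resR (ldual_of C) X) C C k id (coact m)) => f.
rewrite (@contr_tmap A M (resR (ldual_of C) X) C C k id f f) //.
  by symmetry; exact: (rhomA k m f).
exact: (rhomD k).
Qed.

Definition rat_corestr_fun (m : M) : rat_comod hC X :=
  Elt (P := rational_subgroup X) (rat_corestr_rational m).

Fact rat_corestrD m n :
  rat_corestr_fun (m + n) = rat_corestr_fun m + rat_corestr_fun n.
Proof. by apply: elt_inj; exact: (rhomD k). Qed.
Fact rat_corestrA m a : rat_corestr_fun (m *> a) = rat_corestr_fun m *> a.
Proof. by apply: elt_inj; exact: kA. Qed.
Fact rat_corestrP m :
  coact (rat_corestr_fun m) = tmap rat_corestr_fun id (coact m).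
Proof.
apply: (rat_coact_uniq hC (X := X)) => f.
rewrite (@contr_tmap _ _ _ _ _ rat_corestr_fun id f f) //;
  [|exact: rat_corestrD|exact: rat_corestrA].
exact: (rhomA k m f).
Qed.

Definition rat_corestr : comod_hom M (rat_comod hC X) :=
  @ComodHom A C M (rat_comod hC X) (RHom rat_corestrD rat_corestrA)
    rat_corestrP.
End RatCorestriction.
End ComoduleStar.

(** * The generator u = [usharp1] of _#C *)

Section Adjunction.
Variables (A B : pzRingType) (beta : {rmorphism A -> B}).
Variables (C : coring A) (D : coring B) (th : coring_hom beta C D).
Hypotheses (hC : locally_projective C) (hD : locally_projective D).
Hypothesis hc : compatible th.
Local Notation U := (usharp hc).
Local Notation ev k := (sharp_fun (elt_val (k : usharp hc))).

Lemma usharpP (h k : U) : ev h =1 ev k -> h = k.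
Proof. by move=> hk; apply: elt_inj; exact: sharpP. Qed.

Fact usharp1_lin : linear_for (beta \; @GRing.mul B) (fun c : C => beta (counit c)).
Proof. by move=> a c d /=; rewrite counitD counitZ rmorphD rmorphM. Qed.
Fact usharp1_in : in_usharpC (mk_linear usharp1_lin : sharp th).
Proof. by exists (lone C). Qed.

(* beta o eps_C = eps_D o theta, which lies in both _#C and _#D *)
Definition usharp1 : U := Elt (P := usharpC th) usharp1_in.

(** This is the unit law f * eps_C = f of *C, composed with beta. *)
Lemma scale_usharp1 (f : ldual C) c : ev (f *: usharp1) c = beta (f c).
Proof.
rewrite [LHS](hscaleE f (elt_val usharp1)).
by congr (beta _); rewrite -[in RHS](mulr1 f); symmetry; exact: lstarE.
Qed.

(** Since theta(c_1) beta(eps_C(c_2)) = theta(c_1 eps_C(c_2)), the counit law collapses the sum to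
    theta(c). *)
Lemma usharp1_ract (g : ldual D) c : ev (usharp1 *> g) c = g (th c).
Proof.
rewrite [LHS](hractE (elt_val usharp1) g); congr (g _).
rewrite -[in RHS](counitr c) (@tsum_morph _ _ _ _ _ _ th).
- by apply: eq_tsum => c1 c2; rewrite theta_ract.
- by apply: (@addrI _ (th 0)); rewrite -thetaD !addr0.
- exact: thetaD.
Qed.

Lemma usharp1_bal (f : ldual C) (g : ldual D) :
  (forall c, beta (f c) = g (th c)) -> f *: usharp1 = usharp1 *> g.
Proof.
by move=> fg; apply: usharpP => c; rewrite scale_usharp1 usharp1_ract fg.
Qed.

Lemma usharp_gen (k : U) : exists f : ldual C, k = f *: usharp1.
Proof.
have [f kf] := eltP k; exists f; apply: usharpP => c.
by rewrite scale_usharp1 -kf.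
Qed.

(** Compatibility acts through the type [U]: u <- g stays in _#C, so the generator property yields
    f. *)
Lemma usharp1_lift (g : ldual D) :
  exists2 f : ldual C, f *: usharp1 = usharp1 *> g &
    forall c, beta (f c) = g (th c).
Proof.
have [f fP] := usharp_gen (usharp1 *> g); exists f => // c.
by rewrite -usharp1_ract fP scale_usharp1.
Qed.

(** * The unit of the adjunction *)

Section Unit.
Variable M : comodule C.

Local Notation BL := (resL beta (reg B)).

Definition unit_fun (m : M) (k : U) : ind_mod beta M :=
  @tmap A M M C BL id (ev k) (coact m).

Lemma unit_funE m k :
  unit_fun m k = tsum (fun n c => @tens A M BL n (ev k c)) (coact m).
Proof. by []. Qed.

Lemma unit_fun_bal (k : U) :
  balanced (fun (n : M) (c : C) => @tens A M BL n (ev k c)).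
Proof. by apply: tmap_bal => //; [exact: sharpD|exact: sharpZ]. Qed.

Fact unit_funDl m n k : unit_fun (m + n) k = unit_fun m k + unit_fun n k.
Proof. by rewrite !unit_funE coactD (tsumD (unit_fun_bal k)). Qed.

Fact unit_funDr m k l : unit_fun m (k + l) = unit_fun m k + unit_fun m l.
Proof.
rewrite !unit_funE /tsum -big_split; apply: eq_bigr => p _.
exact: (@tensDr A M BL).
Qed.

Lemma unit_fun_ractl (m : M) (a : A) k :
  unit_fun (m *> a) k =
  tsum (fun n c => @tens A M BL n (ev k (c *> a))) (coact m).
Proof.
rewrite unit_funE coact_ract.
have bal : balanced (fun (n : M) (c : C) => @tens A M BL n (ev k (c *> a))).
  split=> [n n' c|n c c'|n b c]; first exact: (@tensDl A M BL).
  - by rewrite ractDl sharpD (@tensDr A M BL).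
  - by rewrite lractA sharpZ (@tens_bal A M BL).
apply: (tensor_ext (f := fun u => tsum _ (u *> a))) => [u v|u v|n c].
- by rewrite ractDl (tsumD (unit_fun_bal k)).
- exact: (tsumD bal).
- by rewrite tens_ract (tsum_tens (unit_fun_bal k)) (tsum_tens bal).
Qed.

(** By coassociativity both sides are Sigma m_0 (x) k(m_1 f(m_2)). This is the *C-linearity of the
    unit in m. *)
Fact unit_fun_scale m (f : ldual C) k :
  unit_fun (coact_star m f) k = unit_fun m (f *: k).
Proof.
pose T (n : M) (c d : C) : ind_mod beta M :=
  @tens A M BL n (ev k (c *> f d)).
transitivity (tsum (fun m0 d => tsum (fun n c => T n c d) (coact m0)) (coact m)).
  rewrite /coact_star /contr (@tsum_morph _ _ _ _ _ _ (unit_fun^~ k)).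
  - by apply: eq_tsum => n c; rewrite unit_fun_ractl.
  - by apply: (@addrI _ (unit_fun 0 k)); rewrite -unit_funDl !addr0.
  - by move=> x y; exact: unit_funDl.
rewrite coact_tsumA.
- rewrite unit_funE; apply: eq_tsum => n c.
  symmetry; exact: (@tsum_morph _ _ _ BL _ _ (@tens A M BL n) _
    (@tens0r A M BL n) (@tensDr A M BL n)).
- move=> d; split=> [n n' c|n c c'|n b c]; first exact: (@tensDl A M BL).
  + by rewrite /T ractDl sharpD (@tensDr A M BL).
  + by rewrite /T lractA sharpZ (@tens_bal A M BL).
- move=> n; split=> [c c' d|c d d'|c b d].
  + by rewrite /T ractDl sharpD (@tensDr A M BL).
  + by rewrite /T ldualD ractDr sharpD (@tensDr A M BL).
  + by rewrite /T ractA ldualZ.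
Qed.

(** The counit law again; the first triangle identity rests on this value. *)
Lemma unit_fun1 m : unit_fun m usharp1 = @tens A M BL m 1.
Proof.
rewrite -[in RHS](coact_counit m).
rewrite [RHS](@tsum_morph _ _ _ _ _ _ (fun m => @tens A M BL m 1)).
- by apply: eq_tsum => n c; rewrite ind_bal_l tens_ract; congr tens;
    symmetry; exact: mul1r.
- exact: (@tens0l A M BL).
- by move=> x y; exact: (@tensDl A M BL).
Qed.

(** By coassociativity both sides are Sigma m_0 (x) g(theta(m_1) k(m_2)). Hence [unit_fun m] is
    *D-linear on _#C. *)
Fact unit_fun_ract m k (g : ldual D) :
  unit_fun m (k *> g) = coact_star (unit_fun m k : ind_obj th M) g.
Proof.
pose T (n : M) (c d : C) : ind_mod beta M :=
  @tens A M BL n (g (th c *> ev k d)).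
symmetry.
transitivity (tsum (fun m0 d => tsum (fun n c => T n c d) (coact m0)) (coact m)).
  rewrite unit_funE.
  rewrite (@tsum_morph _ _ _ _ _ _ (fun w : ind_obj th M => coact_star w g)).
  - apply: eq_tsum => m0 d; rewrite /coact_star [coact _]ind_coact_tens.
    rewrite (@tsum_morph _ _ _ _ _ _ (contr g)).
    + apply: eq_tsum => n c; rewrite /ind_term contr_tens [LHS]tens_ract.
      by congr tens; exact: mul1r.
    + exact: contr0.
    + exact: contrD.
  - apply: (@addrI _ (coact_star (0 : ind_obj th M) g)).
    by rewrite -coact_starDl !addr0.
  - by move=> x y; exact: (@coact_starDl _ _ (ind_obj th M)).
rewrite coact_tsumA.
- rewrite unit_funE; apply: eq_tsum => n c.
  symmetry; exact: (@tsum_morph _ _ _ BL _ _ (@tens A M BL n) _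
    (@tens0r A M BL n) (@tensDr A M BL n)).
- move=> d; split=> [n n' c|n c c'|n b c]; first exact: (@tensDl A M BL).
  + by rewrite /T thetaD ractDl ldualD (@tensDr A M BL).
  + by rewrite /T (@tens_bal A M BL) thetaZ lractA ldualZ.
- move=> n; split=> [c c' d|c d d'|c b d].
  + by rewrite /T thetaD ractDl ldualD (@tensDr A M BL).
  + by rewrite /T sharpD ractDr ldualD (@tensDr A M BL).
  + by rewrite /T theta_ract sharpZ ractA.
Qed.

Definition unit_rhom (m : M) : coind_hom hc (ind_obj th M) :=
  @RHom _ U (comod_star (ind_obj th M)) (unit_fun m) (unit_funDr m)
    (unit_fun_ract m).

Fact unit_rhomD (m n : comod_star M) :
  unit_rhom (m + n) = unit_rhom m + unit_rhom n.
Proof. by apply: rhomP => k; exact: unit_funDl. Qed.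
Fact unit_rhomA (m : comod_star M) (f : ldual C) :
  unit_rhom (m *> f) = unit_rhom m *> f.
Proof. by apply: rhomP => k; exact: unit_fun_scale. Qed.

Definition coind_unit : comod_hom M (coind_obj hC hc (ind_obj th M)) :=
  rat_corestr hC (RHom unit_rhomD unit_rhomA).
End Unit.

Lemma unit_fun_natural (M M' : comodule C) (f : comod_hom M M') m k :
  unit_fun (f m) k = @ind_map_fun A B beta C M M' f (unit_fun m k).
Proof.
rewrite [LHS]unit_funE comod_homP tsum_tmap //;
  [|exact: rhomD|exact: rhomA|exact: unit_fun_bal].
rewrite [in RHS]unit_funE [RHS](@tsum_morph _ _ _ _ _ _ (ind_map_fun f)).
- by apply: eq_tsum => n c; rewrite ind_map_fun_tens.
- by apply: tmap0 => //; [exact: rhomD|exact: rhomA].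
- by move=> x y; exact: ind_map_funD.
Qed.

(** * The counit of the adjunction *)

Section Counit.
Variable N : comodule D.
Local Notation X := (coind_obj hC hc N).
Local Notation BL := (resL beta (reg B)).

Definition coind_ev (x : X) (k : U) : N := (rat_val x : coind_hom hc N) k.

Lemma coind_evD x y k : coind_ev (x + y) k = coind_ev x k + coind_ev y k.
Proof. by []. Qed.

Lemma coind_ev_star x (f : ldual C) k :
  coind_ev (coact_star x f) k = coind_ev x (f *: k).
Proof. by rewrite /coind_ev /coact_star [rat_val _](contr_rat_coact hC). Qed.

Lemma coind_ev_ract x k (g : ldual D) :
  coind_ev x (k *> g) = coact_star (coind_ev x k) g.
Proof. exact: (rhomA (rat_val x : coind_hom hc N) k g). Qed.

(** The forms eps_C(-) a and eps_D(-) beta(a) act alike on u, as eps_D o theta = beta o eps_C. This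
    balances [counit_fun] over A. *)
Lemma coind_ev1A x (a : A) :
  coind_ev (x *> a) usharp1 = coind_ev x usharp1 *> beta a.
Proof.
rewrite -coact_star_of coind_ev_star -[RHS]coact_star_of -coind_ev_ract.
rewrite (usharp1_bal (g := ldual_of D (beta a))) // => c.
by rewrite [LHS]rmorphM -(theta_counit th).
Qed.

(** Each x_0(u) beta(f(x_1)) is (x_0 f(x_1))(u), and these add up to (x f)(u). Both the second
    triangle identity and the *D-linearity of the counit rest on this. *)
Lemma tsum_coind_ev x (f : ldual C) :
  tsum (fun y c => coind_ev y usharp1 *> beta (f c)) (coact x) =
  coind_ev x (f *: usharp1).
Proof.
rewrite -coind_ev_star /coact_star /contr.
rewrite (@tsum_morph _ _ _ _ _ _ (coind_ev^~ usharp1)) //.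
by apply: eq_tsum => y c; rewrite coind_ev1A.
Qed.

Definition counit_fun (w : ind_mod beta X) : N :=
  @tsum A X BL N (fun x b => coind_ev x usharp1 *> (b : B)) w.

Fact counit_fun_bal :
  @balanced A X BL N (fun x b => coind_ev x usharp1 *> (b : B)).
Proof.
split=> [x y b|x b b'|x a b].
- by rewrite coind_evD ractDl.
- exact: ractDr.
- by rewrite coind_ev1A ractA.
Qed.

Lemma counit_fun_tens x (b : B) :
  counit_fun (@tens A X BL x b) = coind_ev x usharp1 *> b.
Proof. exact: (tsum_tens counit_fun_bal). Qed.

Fact counit_funD (v w : comod_star (ind_obj th X)) :
  counit_fun (v + w) = counit_fun v + counit_fun w.
Proof. exact: (tsumD counit_fun_bal). Qed.

Lemma counit_fun0 : counit_fun 0 = 0.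
Proof. exact: (tsum0 counit_fun_bal). Qed.

Lemma counit_unit_fun x k : counit_fun (unit_fun x k) = coind_ev x k.
Proof.
have [f ->] := usharp_gen k; rewrite -tsum_coind_ev unit_funE.
rewrite (@tsum_morph _ _ _ _ _ _ counit_fun).
- by apply: eq_tsum => y c; rewrite counit_fun_tens scale_usharp1.
- exact: counit_fun0.
- exact: counit_funD.
Qed.

Fact counit_fun_star (w : comod_star (ind_obj th X)) (g : ldual D) :
  counit_fun (w *> g) = (counit_fun w : comod_star N) *> g.
Proof.
apply: (tensor_ext (M := X) (N := BL)
  (f := fun w : comod_star (ind_obj th X) => counit_fun (w *> g))
  (g := fun w => (counit_fun w : comod_star N) *> g)) => {w}.
- by move=> v w /=; rewrite [in LHS]ractDl counit_funD.
- by move=> v w /=; rewrite counit_funD ractDl.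
move=> x b.
transitivity (coact_star (counit_fun (@tens A X BL x b)) g); last by [].
rewrite counit_fun_tens coact_star_ract -coind_ev_ract.
(* The product [ldual_of D b * g] is d |-> g(d b), so beta(f(c)) = g(theta(c) b). Both sides thus
   become Sigma x_0(u) g(theta(x_1) b). *)
have [f <- fP] := usharp1_lift (ldual_of D b * g).
rewrite -tsum_coind_ev.
transitivity (counit_fun (contr g (@ind_coact A B beta C D th X (@tens A X BL x b)))).
  by [].
rewrite ind_coact_tens (@tsum_morph _ _ _ _ _ _ (fun u => counit_fun (contr g u))).
- apply: eq_tsum => y c; rewrite /ind_term contr_tens.
  rewrite tens_ract counit_fun_tens fP; congr (_ *> _).
  transitivity (g (th c *> b)); first exact: mul1r.
  rewrite [RHS](lstarE (ldual_of D b)); congr (g _).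
  by symmetry; exact: (@coact_star_of _ _ (coring_comod D)).
- by rewrite contr0 counit_fun0.
- by move=> u v; rewrite contrD counit_funD.
Qed.

Definition coind_counit : comod_hom (ind_obj th X) N :=
  star_comod_hom hD
    (@RHom _ (comod_star (ind_obj th X)) (comod_star N) counit_fun
       counit_funD counit_fun_star).
End Counit.
End Adjunction.

(** * Naturality and the triangle identities *)

Theorem theorem5p9 (R : comNzRingType) (A B : ralgebra R)
    (beta : {rmorphism A -> B}) (hbeta : ralg_morphism beta)
    (C : coring A) (D : coring B) (th : coring_hom beta C D)
    (hC : locally_projective C) (hD : locally_projective D)
    (hcomp : compatible th) :
  left_adjoint (Ind th) (Coind hC hcomp).
Proof.
pose eta : forall M : comod_cat C, cat_hom M (Coind hC hcomp (Ind th M)) :=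
  coind_unit hC hcomp.
pose eps : forall N : comod_cat D, cat_hom (Ind th (Coind hC hcomp N)) N :=
  @coind_counit _ _ _ _ _ _ hC hD hcomp.
apply: (left_adjoint_unit_counit (eta := eta) (eps := eps)).
- move=> M M' f; apply: comod_hom_eq => m; apply: elt_inj; apply: rhomP => k.
  exact: unit_fun_natural.
(* On x (x) b the square reads g(x(u) b) = g(x(u)) b. *)
- move=> N N' g; apply: comod_hom_eq.
  apply: tensor_ext => [v w|v w|x b].
  + exact: rhomD.
  + exact: rhomD.
  + rewrite /= ind_map_fun_tens !counit_fun_tens; exact: rhomA.
(* First triangle: m (x) b goes to (m (x) 1) b, the unit at m evaluated at u and multiplied by b. *)
- move=> M; apply: comod_hom_eq.
  apply: tensor_ext => [v w|//|m b]; first exact: rhomD.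
  rewrite /= ind_map_fun_tens counit_fun_tens /coind_ev /=.
  rewrite unit_fun1 tens_ract; congr tens; exact: mul1r.
- move=> N; apply: comod_hom_eq => x; apply: elt_inj; apply: rhomP => k.
  exact: counit_unit_fun.
Qed.
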